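(* Let $P(\tau)=\theta\begin{bmatrix}1/5\\1/5\end{bmatrix}(0,\tau)\,\theta\begin{bmatrix}1/5\\9/5\end{bmatrix}(0,\tau)$. For every $M=\begin{pmatrix} a&b\\ c&d\end{pmatrix}\in\Gamma_{\theta,5}$ and $\tau\in\mathscr{H}$, $P(M\tau)=\nu(M)(c\tau+d)P(\tau)$ with $\nu(M)=\nu_\eta^6(M)\exp\!\left(\frac{\pi i}{5}E\right)$, where $E=-\frac{4b}{5}-\frac{8ab}{5}-\frac{8cd}{5}$ if $M\equiv\begin{pmatrix}1&0\\0&1\end{pmatrix}\pmod 5$; $E=-\frac{6b}{5}-\frac{8ab}{5}-\frac{8cd}{5}$ if $M\equiv\begin{pmatrix}-1&0\\0&-1\end{pmatrix}\pmod 5$; $E=-5-\frac{4d}{5}-\frac{8ab}{5}-\frac{8cd}{5}$ if $M\equiv\begin{pmatrix}0&-1\\1&0\end{pmatrix}\pmod 5$; $E=-5+\frac{4d}{5}-\frac{8ab}{5}-\frac{8cd}{5}$ if $M\equiv\begin{pmatrix}0&1\\-1&0\end{pmatrix}\pmod 5$.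
   Context: $\mathscr{H}$ is the upper half plane, $M\tau=\frac{a\tau+b}{c\tau+d}$. $\theta\begin{bmatrix}\epsilon\\ \epsilon'\end{bmatrix}(v,\tau)=\sum_{n\in\mathbb{Z}}\exp\!\Big(2\pi i\Big[\tfrac12\big(n+\tfrac{\epsilon}{2}\big)^2\tau+\big(n+\tfrac{\epsilon}{2}\big)\big(v+\tfrac{\epsilon'}{2}\big)\Big]\Big)$. $\Gamma_{\theta,5}=\{M\in SL(2,\mathbb{Z}): M\equiv\pm\begin{pmatrix}1&0\\0&1\end{pmatrix}\text{ or }\pm\begin{pmatrix}0&-1\\1&0\end{pmatrix}\pmod 5\}$. $\eta(\tau)=q^{1/24}\prod_{n\ge1}(1-q^n)$, $q=e^{2\pi i\tau}$; $\nu_\eta$ is its multiplier system, $\eta(M\tau)=\nu_\eta(M)(c\tau+d)^{1/2}\eta(\tau)$ with branch $-\pi\le\arg(c\tau+d)<\pi$; explicitly $\nu_\eta(M)=\left(\frac{d}{c}\right)^{*}\exp\{\frac{\pi i}{12}[(a+d)c-bd(c^2-1)-3c]\}$ if $c$ odd, $\nu_\eta(M)=\left(\frac{c}{d}\right)_{*}\exp\{\frac{\pi i}{12}[(a+d)c-bd(c^2-1)+3d-3-3cd]\}$ if $c$ even, with $\left(\frac{c}{d}\right)^{*}=\left(\frac{c}{|d|}\right)$, $\left(\frac{c}{d}\right)_{*}=\left(\frac{c}{|d|}\right)(-1)^{\frac{\operatorname{sign}c-1}{2}\frac{\operatorname{sign}d-1}{2}}$ (Jacobi symbols). *)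

(* Defs.v *)
From Stdlib Require Import Reals ZArith List.
From Coquelicot Require Import Coquelicot.
From mathcomp Require prime.

Open Scope R_scope.

Definition cexp (z : C) : C :=
  (exp (Re z) * cos (Im z), exp (Re z) * sin (Im z)).

Fixpoint zpartial (f : Z -> C) (N : nat) : C :=
  match N with
  | O => f 0%Z
  | S k => Cplus (zpartial f k)
                 (Cplus (f (Z.of_nat (S k))) (f (- Z.of_nat (S k))%Z))
  end.

Definition zsum (f : Z -> C) : C :=
  (real (Lim_seq (fun N => Re (zpartial f N))),
   real (Lim_seq (fun N => Im (zpartial f N)))).

Definition theta (eps eps' : R) (v tau : C) : C :=
  zsum (fun n : Z =>
    let r := IZR n + eps / 2 in
    cexp (Cmult (Cmult (RtoC (2 * PI)) Ci)
                (Cplus (Cmult (RtoC (r ^ 2 / 2)) tau)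
                       (Cmult (RtoC r) (Cplus v (RtoC (eps' / 2))))))).

Definition P (tau : C) : C :=
  Cmult (theta (1/5) (1/5) (RtoC 0) tau) (theta (1/5) (9/5) (RtoC 0) tau).

Definition moebius (a b c d : Z) (tau : C) : C :=
  Cdiv (Cplus (Cmult (RtoC (IZR a)) tau) (RtoC (IZR b)))
       (Cplus (Cmult (RtoC (IZR c)) tau) (RtoC (IZR d))).

Definition cong5 (x y : Z) : Prop := Z.modulo (x - y) 5 = 0%Z.

Definition mat_cong5 (a b c d a' b' c' d' : Z) : Prop :=
  cong5 a a' /\ cong5 b b' /\ cong5 c c' /\ cong5 d d'.

Definition in_Gamma_theta5 (a b c d : Z) : Prop :=
  (a * d - b * c = 1)%Z /\
  (mat_cong5 a b c d 1 0 0 1 \/ mat_cong5 a b c d (-1) 0 0 (-1) \/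
   mat_cong5 a b c d 0 (-1) 1 0 \/ mat_cong5 a b c d 0 1 (-1) 0).

Definition legendre (a : Z) (p : nat) : Z :=
  let pz := Z.of_nat p in
  if Z.eqb (Z.modulo a pz) 0 then 0%Z
  else if existsb (fun x : nat =>
            Z.eqb (Z.modulo (Z.of_nat x * Z.of_nat x - a) pz) 0)
          (seq 0 p)
       then 1%Z else (-1)%Z.

Definition jacobi (a : Z) (n : nat) : Z :=
  fold_right (fun p acc => (Z.pow (legendre a p) (Z.of_nat (prime.logn p n)) * acc)%Z)
             1%Z (prime.primes n).

Definition jacobi_up (c d : Z) : Z := jacobi c (Z.abs_nat d).

(** (c/d)_* = (c/|d|) (-1)^{((sign c - 1)/2)((sign d - 1)/2)}, with the
    convention sign 0 = -1. *)
Definition sgn' (x : Z) : Z := if Z.ltb 0 x then 1%Z else (-1)%Z.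

Definition jacobi_low (c d : Z) : Z :=
  (jacobi c (Z.abs_nat d) *
   Z.pow (-1) (((sgn' c - 1) / 2) * ((sgn' d - 1) / 2)))%Z.

Definition nu_eta (a b c d : Z) : C :=
  if Z.odd c then
    Cmult (RtoC (IZR (jacobi_up d c)))
      (cexp (Cmult (RtoC (PI / 12)) (Cmult Ci (RtoC (IZR
        ((a + d) * c - b * d * (c * c - 1) - 3 * c)%Z)))))
  else
    Cmult (RtoC (IZR (jacobi_low c d)))
      (cexp (Cmult (RtoC (PI / 12)) (Cmult Ci (RtoC (IZR
        ((a + d) * c - b * d * (c * c - 1) + 3 * d - 3 - 3 * c * d)%Z))))).

Definition cong5b (x y : Z) : bool := Z.eqb (Z.modulo (x - y) 5) 0.
Definition mat_cong5b (a b c d a' b' c' d' : Z) : bool :=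
  andb (cong5b a a') (andb (cong5b b b') (andb (cong5b c c') (cong5b d d'))).

Definition E_exp (a b c d : Z) : R :=
  let A := IZR a in let B := IZR b in let Cc := IZR c in let D := IZR d in
  let common := - (8 * A * B / 5) - (8 * Cc * D / 5) in
  if mat_cong5b a b c d 1 0 0 1 then - (4 * B / 5) + common
  else if mat_cong5b a b c d (-1) 0 0 (-1) then - (6 * B / 5) + common
  else if mat_cong5b a b c d 0 (-1) 1 0 then -5 - (4 * D / 5) + common
  else -5 + (4 * D / 5) + common.
  (* the last branch is the case M = [[0,1],[-1,0]] mod 5 *)

Definition nu (a b c d : Z) : C :=
  Cmult (Cpow (nu_eta a b c d) 6)
        (cexp (Cmult (RtoC (PI / 5)) (Cmult Ci (RtoC (E_exp a b c d))))).

(* Main.v *)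
Require Import Defs.
From Stdlib Require Import Reals ZArith Lra Lia Psatz List.
From Coquelicot Require Import Coquelicot.
From mathcomp Require ssrbool eqtype ssrnat seq div prime.
Open Scope R_scope.

(** Write [th p q] for the theta constant with characteristic [(2p, 2q)] and
    [klein x y = exp (- pi i (x y + x)) th (x + 1/2) (y + 1/2)]: this is the Klein form
    of [x tau + y] times [eta^3]. A product of two such functions has integral weight 1,
    so no square root of [c tau + d] has to be chosen, and on the generators of SL(2, Z)
    it satisfies
    [klein_u klein_v (M tau) = nu_eta(M)^6 (c tau + d) klein_(uM) klein_(vM) (tau)].
    Here [nu_eta^6] is a fourth root of unity whose exponent depends only on [M] modulo 4,
    so that its compatibility with the generators is a finite computation. The function
    [P] is a constant times [klein_u klein_v] with [u = (-2/5, -2/5)], [v = (-2/5, 2/5)],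
    and for [M] in [Gamma_(theta,5)] the pair [uM, vM] equals [u, v] up to order, signs
    and even integral shifts, which produces the remaining factor.

    The inversion formula is Poisson summation. Integrating [g] against the Fejer kernel
    over [[-m-1/2, m+1/2]], then letting [m] and the order of the kernel tend to infinity,
    gives the sum of the [g n] on one side and the Cesaro mean of the Fourier integrals on
    the other. The Gaussian integrals [int lam exp (pi i (lam x + mu)^2) dx] do not depend
    on [lam] in the open first quadrant nor on [mu], since their derivative along a segment
    is a boundary term; the common value is found from [tau = i]. *)

(** * Bilateral sums *)

Definition is_Clim (u : nat -> C) (l : C) : Prop :=
  is_lim_seq (fun n => Re (u n)) (Re l) /\ is_lim_seq (fun n => Im (u n)) (Im l).

(** [zsum] returns a value even for a divergent series, so identities are proved for this predicate
    and then transferred by [is_zsum_unique]. *)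
Definition is_zsum (f : Z -> C) (l : C) : Prop := is_Clim (zpartial f) l.

Lemma C_eq (z w : C) : Re z = Re w -> Im z = Im w -> z = w.
Proof. destruct z, w; simpl; intros -> ->; reflexivity. Qed.

Lemma is_Clim_ext (u v : nat -> C) (l : C) :
  (forall n, u n = v n) -> is_Clim u l -> is_Clim v l.
Proof.
  intros H [H1 H2]; split; (eapply is_lim_seq_ext; [|eassumption]);
    intros n; simpl; rewrite H; reflexivity.
Qed.

Lemma is_Clim_plus (u v : nat -> C) (l m : C) :
  is_Clim u l -> is_Clim v m -> is_Clim (fun n => Cplus (u n) (v n)) (Cplus l m).
Proof. intros [H1 H2] [H3 H4]; split; simpl; now apply is_lim_seq_plus'. Qed.

Lemma is_Clim_scal (c : C) (u : nat -> C) (l : C) :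
  is_Clim u l -> is_Clim (fun n => Cmult c (u n)) (Cmult c l).
Proof.
  intros [H1 H2]; split; simpl.
  - apply is_lim_seq_minus';
      [apply (is_lim_seq_scal_l _ (fst c) (Re l)) | apply (is_lim_seq_scal_l _ (snd c) (Im l))]; assumption.
  - apply is_lim_seq_plus';
      [apply (is_lim_seq_scal_l _ (fst c) (Im l)) | apply (is_lim_seq_scal_l _ (snd c) (Re l))]; assumption.
Qed.

Lemma is_zsum_unique (f : Z -> C) (l : C) : is_zsum f l -> zsum f = l.
Proof.
  intros [H1 H2]; unfold zsum.
  rewrite (is_lim_seq_unique _ _ H1), (is_lim_seq_unique _ _ H2).
  simpl; now destruct l.
Qed.

Lemma zpartial_ext (f g : Z -> C) (N : nat) :
  (forall n, f n = g n) -> zpartial f N = zpartial g N.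
Proof. intros H; induction N as [|N IH]; cbn [zpartial]; rewrite ?IH, ?H; reflexivity. Qed.

Lemma is_zsum_ext (f g : Z -> C) (l : C) :
  (forall n, f n = g n) -> is_zsum f l -> is_zsum g l.
Proof. intros H; apply is_Clim_ext; intros; now apply zpartial_ext. Qed.

Lemma zpartial_scal (c : C) (f : Z -> C) (N : nat) :
  zpartial (fun n => Cmult c (f n)) N = Cmult c (zpartial f N).
Proof. induction N as [|N IH]; cbn [zpartial]; rewrite ?IH; ring. Qed.

Lemma is_zsum_scal (c : C) (f : Z -> C) (l : C) :
  is_zsum f l -> is_zsum (fun n => Cmult c (f n)) (Cmult c l).
Proof.
  intros H; eapply is_Clim_ext; [|apply is_Clim_scal, H].
  intros n; simpl; now rewrite zpartial_scal.
Qed.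

Lemma zpartial_opp (f : Z -> C) (N : nat) :
  zpartial (fun n => f (- n)%Z) N = zpartial f N.
Proof.
  induction N as [|N IH]; [reflexivity|].
  cbn [zpartial]; rewrite IH, Z.opp_involutive; ring.
Qed.

Lemma is_zsum_opp (f : Z -> C) (l : C) :
  is_zsum f l -> is_zsum (fun n => f (- n)%Z) l.
Proof. apply is_Clim_ext; intros; now rewrite zpartial_opp. Qed.

(** Gaussian terms satisfy this bound, and it is strong enough both for summability and for the
    vanishing of the boundary terms created by a shift of the index. *)
Definition exp_decay (f : Z -> C) : Prop :=
  exists K, forall n : Z, Cmod (f n) <= K * exp (- Rabs (IZR n)).

Lemma Re_le_Cmod (z : C) : Rabs (Re z) <= Cmod z.
Proof. eapply Rle_trans; [apply Rmax_l|apply Rmax_Cmod]. Qed.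

Lemma Im_le_Cmod (z : C) : Rabs (Im z) <= Cmod z.
Proof. eapply Rle_trans; [apply Rmax_r|apply Rmax_Cmod]. Qed.

Lemma exp_neg_nat (n : nat) : exp (- INR n) = (exp (-1)) ^ n.
Proof.
  induction n as [|n IH]; [simpl; now rewrite Ropp_0, exp_0|].
  rewrite S_INR; replace (- (INR n + 1)) with (-1 + - INR n) by ring.
  rewrite exp_plus, IH; reflexivity.
Qed.

Lemma exp_m1_lt_1 : 0 < exp (-1) < 1.
Proof.
  split; [apply exp_pos|]. rewrite <- exp_0; apply exp_increasing; lra.
Qed.

Lemma is_lim_seq_exp_neg (K : R) : is_lim_seq (fun n => K * exp (- INR n)) 0.
Proof.
  replace (Finite 0) with (Rbar_mult K 0) by (simpl; f_equal; ring).
  apply is_lim_seq_scal_l.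
  apply is_lim_seq_ext with (fun n => exp (-1) ^ n); [intros; now rewrite exp_neg_nat|].
  apply is_lim_seq_geom; rewrite Rabs_pos_eq; apply exp_m1_lt_1 || apply Rlt_le, exp_m1_lt_1.
Qed.

Lemma is_lim_seq_dominated (u : nat -> R) (K : R) :
  (forall n, Rabs (u n) <= K * exp (- INR n)) -> is_lim_seq u 0.
Proof.
  intros H; apply is_lim_seq_abs_0.
  apply is_lim_seq_le_le with (fun _ => 0) (fun n => K * exp (- INR n)).
  - intros n; split; [apply Rabs_pos|apply H].
  - apply is_lim_seq_const.
  - apply is_lim_seq_exp_neg.
Qed.

Lemma ex_lim_partial (a : nat -> R) (c K : R) :
  (forall n, Rabs (a n) <= K * exp (- INR n)) ->
  exists l : R, is_lim_seq (fun n => c + sum_n a n) l.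
Proof.
  intros H.
  assert (E : ex_series a).
  { apply (ex_series_le (V := R_CompleteNormedModule)) with (b := fun n => K * exp (-1) ^ n).
    - intros n; rewrite <- exp_neg_nat; apply H.
    - apply (ex_series_scal_l (V := R_NormedModule) K (fun n => exp (-1) ^ n)), ex_series_geom.
      rewrite Rabs_pos_eq; apply exp_m1_lt_1 || apply Rlt_le, exp_m1_lt_1. }
  destruct E as [l Hl]; exists (c + l).
  apply is_lim_seq_plus'; [apply is_lim_seq_const|exact Hl].
Qed.

Lemma ex_zsum (f : Z -> C) : exp_decay f -> exists l, is_zsum f l.
Proof.
  intros [K HK].
  assert (HK' : forall n : nat, Cmod (f (Z.of_nat (S n))) <= K * exp (- INR n)
                       /\ Cmod (f (- Z.of_nat (S n))%Z) <= K * exp (- INR n)).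
  { assert (K0 : 0 <= K).
    { pose proof (HK 0%Z) as H; rewrite Rabs_R0, Ropp_0, exp_0 in H.
      pose proof (Cmod_ge_0 (f 0%Z)); lra. }
    intros n.
    assert (D : exp (- INR (S n)) <= exp (- INR n)).
    { rewrite S_INR; left; apply exp_increasing; lra. }
    assert (D' := Rmult_le_compat_l _ _ _ K0 D).
    split; eapply Rle_trans; try apply HK.
    - rewrite <- INR_IZR_INZ, Rabs_pos_eq by apply pos_INR; exact D'.
    - rewrite opp_IZR, Rabs_Ropp, <- INR_IZR_INZ, Rabs_pos_eq by apply pos_INR; exact D'. }
  (* The projection is kept abstract so that real and imaginary parts share one argument: the paired
     terms are dominated by a geometric series. *)
  assert (P : forall pr : C -> R, (forall z w, pr (Cplus z w) = pr z + pr w) ->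
     (forall z, Rabs (pr z) <= Cmod z) -> exists l : R, is_lim_seq (fun n => pr (zpartial f n)) l).
  { intros pr padd ple.
    destruct (ex_lim_partial (fun n => pr (Cplus (f (Z.of_nat (S n))) (f (- Z.of_nat (S n))%Z)))
       (pr (f 0%Z)) (2 * K)) as [l Hl].
    - intros n; rewrite padd. eapply Rle_trans; [apply Rabs_triang|].
      pose proof (ple (f (Z.of_nat (S n)))); pose proof (ple (f (- Z.of_nat (S n))%Z)).
      destruct (HK' n); lra.
    - exists l. apply is_lim_seq_incr_1.
      eapply is_lim_seq_ext; [|exact Hl]. intros n; cbv beta.
      set (h := fun n => Cplus (f (Z.of_nat (S n))) (f (- Z.of_nat (S n))%Z)) in *.
      induction n as [|n IH].
      + rewrite sum_O; symmetry; apply padd.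
      + rewrite sum_Sn.
        change (zpartial f (S (S n))) with (Cplus (zpartial f (S n)) (h (S n))).
        rewrite (padd (zpartial f (S n)) (h (S n))), <- IH. symmetry; apply Rplus_assoc. }
  destruct (P Re) as [x Hx]; [reflexivity|apply Re_le_Cmod|].
  destruct (P Im) as [y Hy]; [reflexivity|apply Im_le_Cmod|].
  exists (x, y); split; assumption.
Qed.

Lemma zpartial_shift (f : Z -> C) (N : nat) :
  zpartial (fun n => f (n + 1)%Z) N =
  Cplus (zpartial f N) (Cminus (f (Z.of_nat N + 1)%Z) (f (- Z.of_nat N)%Z)).
Proof.
  induction N as [|N IH].
  - cbn [zpartial]. change (- Z.of_nat 0)%Z with 0%Z. simpl Z.add. ring.
  - cbn [zpartial]; rewrite IH.
    replace (- Z.of_nat (S N) + 1)%Z with (- Z.of_nat N)%Z by lia.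
    replace (Z.of_nat N + 1)%Z with (Z.of_nat (S N)) by lia. ring.
Qed.

(** Symmetric partial sums are not shift invariant: the window moves by one, gaining the term at N +
    1 and losing the one at -N. Both tend to 0 by the decay. *)
Lemma is_zsum_shift (f : Z -> C) (l : C) :
  exp_decay f -> is_zsum f l -> is_zsum (fun n => f (n + 1)%Z) l.
Proof.
  intros [K HK] H.
  apply is_Clim_ext with (fun N => Cplus (zpartial f N)
     (Cminus (f (Z.of_nat N + 1)%Z) (f (- Z.of_nat N)%Z))).
  { intros N; now rewrite zpartial_shift. }
  replace l with (Cplus l (RtoC 0)) by ring.
  apply is_Clim_plus; [exact H|].
  assert (K0 : 0 <= K).
  { pose proof (HK 0%Z) as H'; rewrite Rabs_R0, Ropp_0, exp_0 in H'.
    pose proof (Cmod_ge_0 (f 0%Z)); lra. }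
  assert (B : forall N, Cmod (Cminus (f (Z.of_nat N + 1)%Z) (f (- Z.of_nat N)%Z))
       <= 2 * K * exp (- INR N)).
  { intros N. unfold Cminus. eapply Rle_trans; [apply Cmod_triangle|]. rewrite Cmod_opp.
    pose proof (HK (Z.of_nat N + 1)%Z) as H1; pose proof (HK (- Z.of_nat N)%Z) as H2.
    rewrite opp_IZR, Rabs_Ropp, <- INR_IZR_INZ, Rabs_pos_eq in H2 by apply pos_INR.
    assert (D : exp (- Rabs (IZR (Z.of_nat N + 1))) <= exp (- INR N)).
    { rewrite plus_IZR, <- INR_IZR_INZ, Rabs_pos_eq by (pose proof (pos_INR N); lra).
      left; apply exp_increasing; lra. }
    pose proof (Rmult_le_compat_l _ _ _ K0 D). lra. }
  split; apply is_lim_seq_dominated with (2 * K); intros N;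
    (eapply Rle_trans; [|apply B]); [apply Re_le_Cmod|apply Im_le_Cmod].
Qed.

(** * Poisson summation by the Fejer kernel *)

Fixpoint dirichlet (j : nat) (x : R) : R :=
  match j with
  | O => 1
  | S i => dirichlet i x + 2 * cos (2 * PI * INR (S i) * x)
  end.

(** Unnormalised Fejer kernel, equal to sin^2(pi N x) / sin^2(pi x) away from the integers; its
    integral over a period is [N], not 1. *)
Fixpoint fejer (N : nat) (x : R) : R :=
  match N with
  | O => 0
  | S n => fejer n x + dirichlet n x
  end.

Fixpoint rpartial (g : R -> R) (m : nat) : R :=
  match m with
  | O => g 0
  | S k => rpartial g k + (g (INR (S k)) + g (- INR (S k)))
  end.

(** Multiplication by 1 - cos(2 pi x) turns each summand into a second difference of cosines, so the
    sum telescopes. A second summation gives the closed form of the Fejer kernel. *)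
Lemma dirichlet_telescope (j : nat) (x : R) :
  (1 - cos (2 * PI * x)) * dirichlet j x =
  cos (2 * PI * INR j * x) - cos (2 * PI * INR (S j) * x).
Proof.
  induction j as [|j IH].
  - cbn [dirichlet]. change (INR 0) with 0; change (INR 1) with 1.
    replace (2 * PI * 0 * x) with 0 by ring. rewrite cos_0, Rmult_1_r. f_equal; f_equal; ring.
  - cbn [dirichlet]; rewrite Rmult_plus_distr_l, IH.
    set (u := 2 * PI * INR (S j) * x).
    replace (2 * PI * INR (S (S j)) * x) with (u + 2 * PI * x)
      by (unfold u; rewrite (S_INR (S j)); ring).
    replace (2 * PI * INR j * x) with (u - 2 * PI * x) by (unfold u; rewrite S_INR; ring).
    rewrite cos_plus, cos_minus. ring.
Qed.

Lemma fejer_closed (N : nat) (x : R) :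
  (1 - cos (2 * PI * x)) * fejer N x = 1 - cos (2 * PI * INR N * x).
Proof.
  induction N as [|N IH].
  - cbn [fejer]. change (INR 0) with 0. replace (2 * PI * 0 * x) with 0 by ring.
    rewrite cos_0; ring.
  - cbn [fejer]; rewrite Rmult_plus_distr_l, IH, dirichlet_telescope; ring.
Qed.

Lemma cos_mult_one (t : R) (k : nat) : cos t = 1 -> cos (INR k * t) = 1 /\ sin (INR k * t) = 0.
Proof.
  intros Ht.
  assert (Hs : sin t = 0) by (pose proof (sin2_cos2 t); unfold Rsqr in *; rewrite Ht in *; nra).
  induction k as [|k [IH1 IH2]].
  - simpl; rewrite Rmult_0_l, cos_0, sin_0; auto.
  - rewrite S_INR, Rmult_plus_distr_r, Rmult_1_l, cos_plus, sin_plus, IH1, IH2, Ht, Hs; split; ring.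
Qed.

Lemma fejer_pos (N : nat) (x : R) : 0 <= fejer N x.
Proof.
  pose proof (fejer_closed N x) as H.
  pose proof (COS_bound (2 * PI * x)) as B1; pose proof (COS_bound (2 * PI * INR N * x)) as B2.
  (* The closed form decides the sign unless its factor vanishes; in that case x is an integer and
     every cosine in the kernel equals 1. *)
  destruct (Req_dec (cos (2 * PI * x)) 1) as [E|E].
  - assert (D : forall j, 0 <= dirichlet j x).
    { induction j as [|j IH]; cbn [dirichlet]; [lra|].
      replace (2 * PI * INR (S j) * x) with (INR (S j) * (2 * PI * x)) by ring.
      rewrite (proj1 (cos_mult_one _ (S j) E)); lra. }
    clear H B2; induction N as [|N IH]; cbn [fejer]; [lra|]. specialize (D N); lra.
  - apply Rmult_le_reg_l with (1 - cos (2 * PI * x)); [lra|]. rewrite H; lra.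
Qed.

Lemma continuous_dirichlet (j : nat) (x : R) : continuous (dirichlet j) x.
Proof.
  induction j as [|j IH]; [apply continuous_const|].
  apply (continuous_plus (dirichlet j) (fun x => 2 * cos (2 * PI * INR (S j) * x))); [exact IH|].
  apply (ex_derive_continuous (fun x => 2 * cos (2 * PI * INR (S j) * x))).
  auto_derive; trivial.
Qed.

Lemma continuous_fejer (N : nat) (x : R) : continuous (fejer N) x.
Proof.
  induction N as [|N IH]; [apply continuous_const|].
  apply (continuous_plus (fejer N) (dirichlet N)); [exact IH|apply continuous_dirichlet].
Qed.

Lemma is_RInt_dirichlet (j : nat) (n : Z) :
  is_RInt (dirichlet j) (IZR n - 1/2) (IZR n + 1/2) 1.
Proof.
  induction j as [|j IH].
  - replace 1 with (scal ((IZR n + 1/2) - (IZR n - 1/2)) 1) at 3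
      by (unfold scal; simpl; unfold mult; simpl; field).
    apply (is_RInt_const (V := R_NormedModule)).
  - replace 1 with (plus 1 0) at 3 by (unfold plus; simpl; ring).
    apply (is_RInt_plus (V := R_NormedModule) (dirichlet j)); [exact IH|].
    pose proof PI_RGT_0 as P0. assert (J0 : 0 < INR (S j)) by (apply lt_0_INR; lia).
    (* The endpoints are n + e/2 with e = 1 or -1, where the primitive vanishes because its argument
       is an integer multiple of pi. *)
    assert (Z0 : forall e : Z, sin (2 * PI * INR (S j) * (IZR n + IZR e / 2)) = 0).
    { intros e; apply sin_eq_0_1. exists (Z.of_nat (S j) * (2 * n + e))%Z.
      rewrite mult_IZR, plus_IZR, mult_IZR, <- INR_IZR_INZ. field. }
    set (c := INR (S j)) in *; clearbody c.
    set (f := fun x => sin (2 * PI * c * x) / (PI * c)).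
    replace 0 with (minus (f (IZR n + 1/2)) (f (IZR n - 1/2))).
    + apply (is_RInt_derive (V := R_CompleteNormedModule)); intros x _.
      * unfold f; auto_derive; [trivial|]. field; lra.
      * apply (ex_derive_continuous (fun x => 2 * cos (2 * PI * c * x))).
        auto_derive; trivial.
    + unfold f, minus, plus, opp; simpl AbelianGroup.sort; cbn.
      replace (IZR n - 1/2) with (IZR n + IZR (-1) / 2) by (simpl; field).
      rewrite (Z0 1%Z), (Z0 (-1)%Z). unfold Rdiv; ring.
Qed.

Lemma is_RInt_fejer (N : nat) (n : Z) :
  is_RInt (fejer N) (IZR n - 1/2) (IZR n + 1/2) (INR N).
Proof.
  induction N as [|N IH].
  - replace (INR 0) with (scal ((IZR n + 1/2) - (IZR n - 1/2)) 0)
      by (unfold scal; simpl; unfold mult; simpl; field).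
    apply (is_RInt_const (V := R_NormedModule)).
  - rewrite S_INR. apply (is_RInt_plus (V := R_NormedModule) (fejer N)); [exact IH|].
    apply is_RInt_dirichlet.
Qed.

(** The Taylor bound y - y^3/6 <= sin y together with y <= 2 leaves the factor 1 - 4/6. This crude
    constant suffices because it will be compensated by pi >= 3. *)
Lemma sin_ge_third (y : R) : 0 <= y <= PI / 2 -> y / 3 <= sin y.
Proof.
  intros [H0 H1]. pose proof PI_4 as P4.
  destruct (pre_sin_bound y 0 H0) as [H _]; [lra|].
  unfold sin_approx, sin_term in H; cbn -[INR] in H.
  replace (INR 6) with 6 in H by (simpl; ring); change (INR 1) with 1 in H.
  assert (Y : y * y <= 4) by nra.
  apply Rle_trans with (2 := H). nra.
Qed.

(** With y = x - n, half of 1 - cos(2 pi x) is sin^2(pi |y|), and sin(pi |y|) >= pi |y| / 3 >=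
    |y|. *)
Lemma sq_le_one_minus_cos (n : Z) (x : R) :
  Rabs (x - IZR n) <= 1/2 -> (x - IZR n) ^ 2 <= (1 - cos (2 * PI * x)) / 2.
Proof.
  intros H. set (y := x - IZR n) in *.
  assert (E : cos (2 * PI * x) = cos (2 * (PI * Rabs y))).
  { replace (2 * PI * x) with (2 * (PI * y) + 2 * IZR n * PI) by (unfold y; ring).
    assert (C0 : forall t (k : nat), cos (t + 2 * INR k * PI) = cos t) by (intros; apply cos_period).
    assert (C1 : cos (2 * (PI * y) + 2 * IZR n * PI) = cos (2 * (PI * y))).
    { destruct (Z_le_dec 0 n).
      - rewrite <- (Z2Nat.id n), <- INR_IZR_INZ by lia; apply C0.
      - rewrite <- (C0 _ (Z.to_nat (- n))). f_equal.
        rewrite INR_IZR_INZ, Z2Nat.id, opp_IZR by lia; ring. }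
    rewrite C1. unfold Rabs; destruct (Rcase_abs y); [|reflexivity].
    rewrite <- cos_neg; f_equal; ring. }
  rewrite E, cos_2a_sin.
  pose proof (Rabs_pos y). pose proof PI_RGT_0.
  assert (P3 : 3 <= PI) by (pose proof PI2_3_2; lra).
  assert (S : PI * Rabs y / 3 <= sin (PI * Rabs y)) by (apply sin_ge_third; nra).
  assert (S1 : Rabs y <= sin (PI * Rabs y)) by nra.
  assert (S2 := Rmult_le_compat _ _ _ _ (Rabs_pos y) (Rabs_pos y) S1 S1).
  rewrite <- (pow2_abs y). lra.
Qed.

(** Write y = |x - n|. The closed form gives y^2 F_N <= 1, and y <= e/2 + y^2/(2e) then bounds y F_N
    by (e/2) F_N + 1/(2e), whose integral is explicit. The free parameter [e] replaces a splitting
    of the interval into a neighbourhood of n and its complement. *)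
Lemma fejer_local (g : R -> R) (n : Z) (L e : R) (N : nat) :
  (forall x, continuous g x) -> 0 < e -> 0 <= L ->
  (forall x, Rabs (x - IZR n) <= 1/2 -> Rabs (g x - g (IZR n)) <= L * Rabs (x - IZR n)) ->
  Rabs (RInt (fun x => g x * fejer N x) (IZR n - 1/2) (IZR n + 1/2) - INR N * g (IZR n))
   <= L * (INR N * (e / 2) + / (2 * e)).
Proof.
  intros Hc He HL Hg.
  set (a := IZR n - 1/2). set (b := IZR n + 1/2).
  assert (Ic : forall x, continuous (fun x => g x * fejer N x) x).
  { intros x; apply (continuous_mult g (fejer N)); [apply Hc|apply continuous_fejer]. }
  assert (I1 : is_RInt (fun x => g x * fejer N x) a b (RInt (fun x => g x * fejer N x) a b)).
  { apply (RInt_correct (V := R_CompleteNormedModule)),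
      (ex_RInt_continuous (V := R_CompleteNormedModule)); intros; apply Ic. }
  assert (I2 : is_RInt (fun x => minus (g x * fejer N x) (scal (g (IZR n)) (fejer N x))) a b
    (minus (RInt (fun x => g x * fejer N x) a b) (scal (g (IZR n)) (INR N)))).
  { apply (is_RInt_minus (V := R_NormedModule)); [exact I1|].
    apply (is_RInt_scal (V := R_NormedModule)), is_RInt_fejer. }
  assert (I3 : is_RInt (fun x => plus (scal (L * (e / 2)) (fejer N x)) (L * / (2 * e))) a b
    (plus (scal (L * (e / 2)) (INR N)) (scal (b - a) (L * / (2 * e))))).
  { apply (is_RInt_plus (V := R_NormedModule)).
    - apply (is_RInt_scal (V := R_NormedModule)), is_RInt_fejer.
    - apply (is_RInt_const (V := R_NormedModule)). }
  replace (L * (INR N * (e / 2) + / (2 * e))) with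
    (plus (scal (L * (e / 2)) (INR N)) (scal (b - a) (L * / (2 * e)))).
  2:{ unfold plus, scal; simpl; unfold mult; simpl; unfold a, b; field; lra. }
  replace (Rabs _) with (norm (minus (RInt (fun x => g x * fejer N x) a b) (scal (g (IZR n)) (INR N)))).
  2:{ unfold norm; simpl; unfold abs; simpl. f_equal.
      unfold minus, plus, opp, scal; simpl; unfold mult; simpl; ring. }
  refine (norm_RInt_le (V := R_NormedModule) _ _ a b _ _ _ _ I2 I3); [unfold a, b; lra|].
  intros x Hx.
  simpl. unfold norm; simpl; unfold abs; simpl.
  unfold minus, plus, opp, scal; simpl; unfold mult; simpl.
  replace (g x * fejer N x + - (g (IZR n) * fejer N x)) with ((g x - g (IZR n)) * fejer N x) by ring.
  rewrite Rabs_mult, (Rabs_pos_eq (fejer N x)) by apply fejer_pos.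
  assert (Hx' : Rabs (x - IZR n) <= 1/2) by (apply Rabs_le; unfold a, b in Hx; lra).
  specialize (Hg x Hx'). pose proof (fejer_pos N x) as F0.
  set (y := Rabs (x - IZR n)) in *. assert (y0 : 0 <= y) by apply Rabs_pos.
  assert (Y : y ^ 2 * fejer N x <= 1).
  { pose proof (sq_le_one_minus_cos n x Hx') as Q. rewrite <- pow2_abs in Q. fold y in Q.
    pose proof (fejer_closed N x). pose proof (COS_bound (2 * PI * INR N * x)). nra. }
  assert (AM : y <= e / 2 + y ^ 2 * / (2 * e)).
  { assert (0 <= (y - e) ^ 2 * / (2 * e)).
    { apply Rmult_le_pos; [apply pow2_ge_0|]. left; apply Rinv_0_lt_compat; lra. }
    replace (e / 2 + y ^ 2 * / (2 * e)) with (y + (y - e) ^ 2 * / (2 * e)) by (field; lra). lra. }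
  apply Rle_trans with (L * (y * fejer N x)).
  { rewrite <- Rmult_assoc. apply Rmult_le_compat_r; assumption. }
  replace (L * (e / 2) * fejer N x + L * / (2 * e)) with (L * (e / 2 * fejer N x + 1 * / (2 * e))) by ring.
  apply Rmult_le_compat_l; [assumption|].
  assert (0 < / (2 * e)) by (apply Rinv_0_lt_compat; lra).
  apply Rle_trans with ((e / 2 + y ^ 2 * / (2 * e)) * fejer N x); nra.
Qed.

(** The subtracted term makes the induction close, since 2 exp(-(m + 1)) <= exp(-m). What matters is
    the bound 3, uniform in [m]. *)
Lemma rpartial_exp_bound (m : nat) :
  rpartial (fun x => exp (- Rabs x)) m <= 3 - 2 * exp (- INR m).
Proof.
  induction m as [|m IH]; cbn [rpartial].
  - rewrite Rabs_R0; simpl; rewrite Ropp_0, exp_0; lra.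
  - rewrite Rabs_Ropp, Rabs_pos_eq by apply pos_INR.
    assert (D : 2 * exp (- INR (S m)) <= exp (- INR m)).
    { rewrite S_INR. replace (- INR m) with (1 + - (INR m + 1)) by ring.
      rewrite exp_plus. pose proof (exp_pos (- (INR m + 1))). pose proof (exp_ineq1 1). nra. }
    lra.
Qed.

Lemma RInt_centered_succ (f : R -> R) (m : nat) :
  (forall x, continuous f x) ->
  RInt f (- INR (S m) - 1/2) (INR (S m) + 1/2) =
  RInt f (- INR m - 1/2) (INR m + 1/2) +
  (RInt f (INR (S m) - 1/2) (INR (S m) + 1/2) + RInt f (- INR (S m) - 1/2) (- INR (S m) + 1/2)).
Proof.
  intros Hf.
  assert (X : forall a b, ex_RInt f a b).
  { intros; apply (ex_RInt_continuous (V := R_CompleteNormedModule)); intros; apply Hf. }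
  rewrite <- (RInt_Chasles (V := R_CompleteNormedModule) f _ (- INR (S m) + 1/2) _ (X _ _) (X _ _)).
  rewrite <- (RInt_Chasles (V := R_CompleteNormedModule) f (- INR (S m) + 1/2) (INR (S m) - 1/2) _
     (X _ _) (X _ _)).
  replace (- INR (S m) + 1/2) with (- INR m - 1/2) by (rewrite S_INR; field).
  replace (INR (S m) - 1/2) with (INR m + 1/2) by (rewrite S_INR; field).
  unfold plus; simpl AbelianMonoid.sort; cbn -[INR]. ring.
Qed.

(** The local estimates are added over |n| <= m. The Lipschitz constants decay like exp(-|n|), so
    the total error stays bounded as [m] grows. *)
Lemma fejer_global (g : R -> R) (K e : R) (N m : nat) :
  (forall x, continuous g x) -> 0 < e -> 0 <= K ->
  (forall (n : Z) x, Rabs (x - IZR n) <= 1/2 ->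
     Rabs (g x - g (IZR n)) <= K * exp (- Rabs (IZR n)) * Rabs (x - IZR n)) ->
  Rabs (RInt (fun x => g x * fejer N x) (- INR m - 1/2) (INR m + 1/2) - INR N * rpartial g m)
   <= K * (INR N * (e / 2) + / (2 * e)) * rpartial (fun x => exp (- Rabs x)) m.
Proof.
  intros Hc He HK Hg.
  assert (Ic : forall x, continuous (fun x => g x * fejer N x) x).
  { intros x; apply (continuous_mult g (fejer N)); [apply Hc|apply continuous_fejer]. }
  assert (Loc := fun n : Z => fejer_local g n (K * exp (- Rabs (IZR n))) e N Hc He
    (Rmult_le_pos _ _ HK (Rlt_le _ _ (exp_pos _))) (Hg n)).
  induction m as [|m IH].
  - cbn [rpartial]. specialize (Loc 0%Z). change (INR 0) with 0.
    replace (- 0 - 1/2) with (0 - 1/2) by ring. lra.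
  - rewrite RInt_centered_succ by exact Ic. cbn [rpartial].
    assert (L1 := Loc (Z.of_nat (S m))). assert (L2 := Loc (- Z.of_nat (S m))%Z).
    rewrite opp_IZR in L2. rewrite <- INR_IZR_INZ in L1, L2.
    set (I0 := RInt _ _ _) in *. set (I1 := RInt _ _ _) in L1 |- *.
    set (I2 := RInt _ _ _) in L2 |- *.
    apply Rabs_le_between in IH, L1, L2. apply Rabs_le_between. lra.
Qed.

Lemma RInt_plus_continuous (f h : R -> R) (a b : R) :
  (forall x, continuous f x) -> (forall x, continuous h x) ->
  RInt (fun x => f x + h x) a b = RInt f a b + RInt h a b.
Proof.
  intros Hf Hh. apply (RInt_plus (V := R_CompleteNormedModule));
   apply (ex_RInt_continuous (V := R_CompleteNormedModule)); intros; auto.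
Qed.

Lemma RInt_scal_continuous (f : R -> R) (k a b : R) :
  (forall x, continuous f x) -> RInt (fun x => k * f x) a b = k * RInt f a b.
Proof.
  intros Hf. apply (RInt_scal (V := R_CompleteNormedModule));
   apply (ex_RInt_continuous (V := R_CompleteNormedModule)); intros; auto.
Qed.

Lemma continuous_cos_lin (c x : R) : continuous (fun x => cos (c * x)) x.
Proof. apply (ex_derive_continuous (fun x => cos (c * x))); auto_derive; trivial. Qed.

Lemma RInt_ext_all (f h : R -> R) (a b : R) :
  (forall x : R, f x = h x) -> RInt f a b = RInt h a b.
Proof. intros H; apply RInt_ext; intros x _; apply H. Qed.

Lemma is_lim_seq_scal_finite (k : R) (u : nat -> R) (l : R) :
  is_lim_seq u l -> is_lim_seq (fun n => k * u n) (k * l).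
Proof. intros H; exact (is_lim_seq_scal_l u k l H). Qed.

Lemma is_lim_seq_abs_finite (u : nat -> R) (l : R) :
  is_lim_seq u l -> is_lim_seq (fun n => Rabs (u n)) (Rabs l).
Proof. intros H; exact (is_lim_seq_abs u l H). Qed.

(** Here [a k] is the k-th cosine integral of [g], and [b] collects the symmetric partial sums of
    the Fourier side. Pairing the frequencies k and -k leaves only cosines; the name refers to this
    pairing, not to a parity of [g]. *)
Lemma poisson_summation_even (g : R -> R) (K : R) (a b : nat -> R) (G l : R) :
  (forall x, continuous g x) -> 0 <= K ->
  (forall (n : Z) x, Rabs (x - IZR n) <= 1/2 ->
     Rabs (g x - g (IZR n)) <= K * exp (- Rabs (IZR n)) * Rabs (x - IZR n)) ->
  (forall k : nat, is_lim_seq (fun m => RInt (fun x => g x * cos (2 * PI * INR k * x))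
      (- INR m - 1/2) (INR m + 1/2)) (a k)) ->
  b O = a O -> (forall k, b (S k) = b k + 2 * a (S k)) ->
  is_lim_seq (rpartial g) G -> is_lim_seq b l -> G = l.
Proof.
  intros Hc HK Hg Ha Hb0 HbS HG Hl.
  assert (D : forall j, is_lim_seq (fun m => RInt (fun x => g x * dirichlet j x)
      (- INR m - 1/2) (INR m + 1/2)) (b j)).
  { induction j as [|j IH].
    - rewrite Hb0. eapply is_lim_seq_ext; [|apply (Ha 0%nat)]. intros m; simpl.
      apply RInt_ext_all; intros x; cbn. rewrite Rmult_0_r, Rmult_0_l, cos_0; reflexivity.
    - rewrite HbS. eapply is_lim_seq_ext;
        [|apply is_lim_seq_plus'; [exact IH|apply (is_lim_seq_scal_finite 2), (Ha (S j))]].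
      intros m; cbv beta.
      rewrite <- RInt_scal_continuous, <- RInt_plus_continuous.
      + apply RInt_ext_all; intros x; cbn [dirichlet]; ring.
      + intros x; apply (continuous_mult g (dirichlet j)); [apply Hc|apply continuous_dirichlet].
      + intros x; apply (continuous_scal_r (V := R_NormedModule) 2).
        apply (continuous_mult g); [apply Hc|apply continuous_cos_lin].
      + intros x; apply (continuous_mult g); [apply Hc|apply continuous_cos_lin]. }
  assert (F : forall N, is_lim_seq (fun m => RInt (fun x => g x * fejer (S N) x)
      (- INR m - 1/2) (INR m + 1/2)) (sum_f_R0 b N)).
  { induction N as [|N IH].
    - eapply is_lim_seq_ext; [|apply (D 0%nat)]. intros m; apply RInt_ext_all; intros x; cbn; ring.
    - cbn [sum_f_R0]. eapply is_lim_seq_ext; [|apply is_lim_seq_plus'; [exact IH|apply (D (S N))]].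
      intros m; cbv beta. rewrite <- RInt_plus_continuous.
      + apply RInt_ext_all; intros x. change (fejer (S (S N)) x) with (fejer (S N) x + dirichlet (S N) x). ring.
      + intros x; apply (continuous_mult g (fejer (S N))); [apply Hc|apply continuous_fejer].
      + intros x; apply (continuous_mult g (dirichlet (S N))); [apply Hc|apply continuous_dirichlet]. }
  (* The order of the limits matters: first [m] tends to infinity for fixed [N] and [e], then [N] by
     Cesaro, and only at the end is [e] chosen. *)
  assert (B : forall e N, 0 < e ->
     Rabs (sum_f_R0 b N / INR (S N) - G) <= 3 * K * (e / 2 + / (2 * e) * / INR (S N))).
  { intros e N He.
    assert (N0 : 0 < INR (S N)) by (apply lt_0_INR; lia).
    assert (I0 : 0 < / (2 * e)) by (apply Rinv_0_lt_compat; lra).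
    assert (L : Rbar_le (Rabs (sum_f_R0 b N - INR (S N) * G))
         (3 * (K * (INR (S N) * (e / 2) + / (2 * e))))).
    { eapply is_lim_seq_le; [|apply is_lim_seq_abs_finite;
         apply is_lim_seq_minus'; [apply F|apply (is_lim_seq_scal_finite (INR (S N))), HG]
         |apply is_lim_seq_const].
      intros m; cbv beta. eapply Rle_trans; [apply (fejer_global g K e); assumption|].
      pose proof (rpartial_exp_bound m). pose proof (exp_pos (- INR m)).
      rewrite Rmult_comm. apply Rmult_le_compat_r; [|lra].
      apply Rmult_le_pos; [assumption|nra]. }
    simpl Rbar_le in L.
    replace (sum_f_R0 b N / INR (S N) - G) with ((sum_f_R0 b N - INR (S N) * G) * / INR (S N))
      by (field; lra).
    rewrite Rabs_mult, (Rabs_pos_eq (/ _)) by (left; now apply Rinv_0_lt_compat).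
    replace (3 * K * (e / 2 + / (2 * e) * / INR (S N))) with
      (3 * (K * (INR (S N) * (e / 2) + / (2 * e))) * / INR (S N)) by (field; lra).
    apply Rmult_le_compat_r; [left; now apply Rinv_0_lt_compat|exact L]. }
  assert (Ce : is_lim_seq (fun N => sum_f_R0 b N / INR (S N)) l).
  (* [Cesaro_1] averages the terms up to [pred n] over [n], hence the shift of the index by one. *)
  { apply is_lim_seq_Reals in Hl. apply Cesaro_1, is_lim_seq_Reals in Hl.
    apply is_lim_seq_incr_1 in Hl. exact Hl. }
  assert (LG : forall e, 0 < e -> Rabs (l - G) <= 3 * K * (e / 2)).
  { intros e He.
    assert (L : Rbar_le (Rabs (l - G)) (3 * K * (e / 2 + / (2 * e) * 0))).
    { eapply is_lim_seq_le; [intros N; apply (B e N He)| |].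
      - apply is_lim_seq_abs_finite, is_lim_seq_minus'; [exact Ce|apply is_lim_seq_const].
      - apply (is_lim_seq_scal_finite (3 * K)).
        apply is_lim_seq_plus'; [apply is_lim_seq_const|].
        apply (is_lim_seq_scal_finite (/ (2 * e))).
        apply (is_lim_seq_incr_1 (fun n => / INR n)).
        apply (is_lim_seq_inv _ p_infty); [apply is_lim_seq_INR|discriminate]. }
    simpl in L. rewrite Rmult_0_r, Rplus_0_r in L. exact L. }
  destruct (Req_dec l G) as [E|E]; [auto|].
  (* With e = |l - G| / (3K + 1), the bound 3Ke/2 is smaller than |l - G|, a contradiction. *)
  assert (A0 : 0 < Rabs (l - G)) by (apply Rabs_pos_lt; lra).
  assert (Q : 0 < Rabs (l - G) / (3 * K + 1)) by (apply Rdiv_lt_0_compat; lra).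
  specialize (LG _ Q).
  set (t := Rabs (l - G)) in *.
  assert (T : t = (3 * K + 1) * (t / (3 * K + 1))) by (field; lra).
  nra.
Qed.

(** * Gaussian integrals *)

Definition CInt (f : R -> C) (a b : R) : C :=
  (RInt (fun x => Re (f x)) a b, RInt (fun x => Im (f x)) a b).

Lemma Re_CInt (f : R -> C) (a b : R) : Re (CInt f a b) = RInt (fun x => Re (f x)) a b.
Proof. reflexivity. Qed.

Lemma Im_CInt (f : R -> C) (a b : R) : Im (CInt f a b) = RInt (fun x => Im (f x)) a b.
Proof. reflexivity. Qed.

Definition gauss (z : C) : C := cexp (Cmult (Cmult (RtoC PI) Ci) (Cmult z z)).

(** Differentiation under the integral sign turns the s-derivative into the integral of the
    x-derivative of [B], that is B(s, b) - B(s, a). The mean value theorem on [0, 1] then bounds the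
    change. *)
Lemma RInt_homotopy (A B D : R -> R -> R) (a b M : R) :
  (forall s x, is_derive (fun s => A s x) s (D s x)) ->
  (forall s x, is_derive (fun x => B s x) x (D s x)) ->
  (forall s x, continuity_2d_pt D s x) ->
  (forall s x, continuous (A s) x) -> (forall s x, continuous (D s) x) ->
  (forall s, 0 <= s <= 1 -> Rabs (B s a) <= M /\ Rabs (B s b) <= M) ->
  Rabs (RInt (A 1) a b - RInt (A 0) a b) <= 2 * M.
Proof.
  intros HA HB HD CA CD HM.
  assert (Der : forall s, is_derive (fun s => RInt (A s) a b) s (B s b - B s a)).
  { intros s.
    replace (B s b - B s a) with (RInt (fun x => Derive (fun u => A u x) s) a b).
    - apply (is_derive_RInt_param A).
      + apply filter_forall; intros u t _; exists (D u t); apply HA.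
      + intros t _; apply continuity_2d_pt_ext with D; [|apply HD].
        intros u v; symmetry; apply is_derive_unique, HA.
      + apply filter_forall; intros u.
        apply (ex_RInt_continuous (V := R_CompleteNormedModule)); intros; apply CA.
    - transitivity (RInt (D s) a b).
      + apply RInt_ext_all; intros x; apply is_derive_unique, HA.
      + apply (is_RInt_unique (V := R_CompleteNormedModule)).
        apply (is_RInt_derive (V := R_CompleteNormedModule) (B s)); intros; [apply HB|apply CD]. }
  destruct (MVT_gen (fun s => RInt (A s) a b) 0 1 (fun s => B s b - B s a)) as (c & Hc & E).
  - intros x _; apply Der.
  - intros x _; apply continuity_pt_filterlim.
    apply (ex_derive_continuous (fun s => RInt (A s) a b)); exists (B x b - B x a); apply Der.
  - cbv beta in E; rewrite E.
    rewrite Rmin_left, Rmax_right in Hc by lra.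
    destruct (HM c Hc) as [H1 H2].
    apply Rabs_le_between in H1, H2. apply Rabs_le_between. lra.
Qed.

Lemma exp_le_mono (x y : R) : x <= y -> exp x <= exp y.
Proof. intros [H| ->]; [left; now apply exp_increasing|apply Rle_refl]. Qed.

(** Completing the square in t = |x|: the maximum of -dl t^2 + (C + 1) t is (C + 1)^2 / (4 dl). *)
Lemma gauss_tail (dl C c : R) : 0 < dl ->
  exists K, 0 <= K /\ forall x, exp (- dl * x ^ 2 + C * Rabs x + c) <= K * exp (- Rabs x).
Proof.
  intros Hd. exists (exp ((C + 1) ^ 2 / (4 * dl) + c)); split; [left; apply exp_pos|].
  intros x. rewrite <- exp_plus. apply exp_le_mono. rewrite <- (pow2_abs x).
  set (t := Rabs x).
  assert (0 <= dl * (t - (C + 1) / (2 * dl)) ^ 2) by (apply Rmult_le_pos; [lra|apply pow2_ge_0]).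
  replace ((C + 1) ^ 2 / (4 * dl) + c + - t) with
   (dl * (t - (C + 1) / (2 * dl)) ^ 2 + (- dl * t ^ 2 + C * t + c)) by (field; lra). lra.
Qed.

(* With [lam s = (p1 + s d1) + i (p2 + s d2)], [z = lam s * x + s (e1 + i e2)] and
   [y = dz/ds], these are the real parts of [e^(i f0)] times [lam e^(pi i z^2)],
   [y e^(pi i z^2)], and their common derivative in [s], respectively [x]. *)
Definition pathA (p1 p2 d1 d2 e1 e2 f0 s x : R) : R :=
  let u := (p1 + s * d1) * x + s * e1 in
  let w := (p2 + s * d2) * x + s * e2 in
  exp (- (2 * PI * (u * w))) *
  ((p1 + s * d1) * cos (PI * (u * u - w * w) + f0) -
   (p2 + s * d2) * sin (PI * (u * u - w * w) + f0)).

Definition pathB (p1 p2 d1 d2 e1 e2 f0 s x : R) : R :=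
  let u := (p1 + s * d1) * x + s * e1 in
  let w := (p2 + s * d2) * x + s * e2 in
  exp (- (2 * PI * (u * w))) *
  ((d1 * x + e1) * cos (PI * (u * u - w * w) + f0) -
   (d2 * x + e2) * sin (PI * (u * u - w * w) + f0)).

Definition pathD (p1 p2 d1 d2 e1 e2 f0 s x : R) : R :=
  let l1 := p1 + s * d1 in
  let l2 := p2 + s * d2 in
  let u := l1 * x + s * e1 in
  let w := l2 * x + s * e2 in
  let y1 := d1 * x + e1 in
  let y2 := d2 * x + e2 in
  let r1 := l1 * (u * y1 - w * y2) - l2 * (u * y2 + w * y1) in
  let r2 := l1 * (u * y2 + w * y1) + l2 * (u * y1 - w * y2) in
  exp (- (2 * PI * (u * w))) *
  ((d1 - 2 * PI * r2) * cos (PI * (u * u - w * w) + f0) -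
   (d2 + 2 * PI * r1) * sin (PI * (u * u - w * w) + f0)).

(** This derivative and the next one agree because the form exp(pi i z^2) dz is closed: lam and y
    are the partial derivatives of z in x and s. In [pathD], r1 + i r2 is the product lam z y,
    symmetric in the two. *)
Lemma is_derive_pathA p1 p2 d1 d2 e1 e2 f0 (s x : R) :
  is_derive (fun s => pathA p1 p2 d1 d2 e1 e2 f0 s x) s (pathD p1 p2 d1 d2 e1 e2 f0 s x).
Proof. unfold pathA, pathD, Rminus; cbv zeta. auto_derive; [trivial|]. ring. Qed.

Lemma is_derive_pathB p1 p2 d1 d2 e1 e2 f0 (s x : R) :
  is_derive (fun x => pathB p1 p2 d1 d2 e1 e2 f0 s x) x (pathD p1 p2 d1 d2 e1 e2 f0 s x).
Proof. unfold pathB, pathD, Rminus; cbv zeta. auto_derive; [trivial|]. ring. Qed.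

Ltac cont2d :=
  lazymatch goal with
  | |- continuity_2d_pt (fun s x => s) _ _ => apply continuity_2d_pt_id1
  | |- continuity_2d_pt (fun s x => x) _ _ => apply continuity_2d_pt_id2
  | |- continuity_2d_pt (fun s x => @?f s x + @?g s x) _ _ => apply (continuity_2d_pt_plus f g); cont2d
  | |- continuity_2d_pt (fun s x => @?f s x - @?g s x) _ _ => apply (continuity_2d_pt_minus f g); cont2d
  | |- continuity_2d_pt (fun s x => @?f s x * @?g s x) _ _ => apply (continuity_2d_pt_mult f g); cont2d
  | |- continuity_2d_pt (fun s x => - @?f s x) _ _ => apply (continuity_2d_pt_opp f); cont2d
  | |- continuity_2d_pt (fun s x => cos (@?f s x)) _ _ =>
      apply (continuity_1d_2d_pt_comp cos f); [apply continuity_cos|cont2d]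
  | |- continuity_2d_pt (fun s x => sin (@?f s x)) _ _ =>
      apply (continuity_1d_2d_pt_comp sin f); [apply continuity_sin|cont2d]
  | |- continuity_2d_pt (fun s x => exp (@?f s x)) _ _ =>
      apply (continuity_1d_2d_pt_comp exp f);
      [apply derivable_continuous_pt, derivable_exp|cont2d]
  | |- _ => apply continuity_2d_pt_const
  end.

Lemma continuity_pathD p1 p2 d1 d2 e1 e2 f0 (s x : R) :
  continuity_2d_pt (pathD p1 p2 d1 d2 e1 e2 f0) s x.
Proof. unfold pathD; cbv zeta. cont2d. Qed.

(** On the whole segment lam has real part at least [r1] and imaginary part at least [r2], so u w
    grows like r1 r2 x^2 uniformly in s. The linear factor y costs at most H exp(|x|). *)
Lemma pathB_bound p1 p2 d1 d2 e1 e2 f0 :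
  0 < p1 -> 0 < p2 -> 0 < p1 + d1 -> 0 < p2 + d2 ->
  exists K, 0 <= K /\ forall s x, 0 <= s <= 1 ->
    Rabs (pathB p1 p2 d1 d2 e1 e2 f0 s x) <= K * exp (- Rabs x).
Proof.
  intros P1 P2 Q1 Q2.
  set (r1 := Rmin p1 (p1 + d1)). set (r2 := Rmin p2 (p2 + d2)).
  assert (R1 : 0 < r1) by (apply Rmin_pos; lra).
  assert (R2 : 0 < r2) by (apply Rmin_pos; lra).
  pose proof PI_RGT_0 as P0.
  set (C := (p1 + Rabs d1) * Rabs e2 + (p2 + Rabs d2) * Rabs e1).
  set (c := Rabs e1 * Rabs e2).
  set (H := Rabs d1 + Rabs d2 + Rabs e1 + Rabs e2).
  (* The extra 1 in the linear coefficient pays for the factor exp(|x|) that dominates y. *)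
  destruct (gauss_tail (2 * PI * (r1 * r2)) (2 * PI * C + 1) (2 * PI * c)) as (K & K0 & HK).
  { apply Rmult_lt_0_compat; [lra|]. apply Rmult_lt_0_compat; assumption. }
  assert (H0 : 0 <= H).
  { unfold H; pose proof (Rabs_pos d1); pose proof (Rabs_pos d2);
    pose proof (Rabs_pos e1); pose proof (Rabs_pos e2); lra. }
  exists (H * K); split; [now apply Rmult_le_pos|].
  intros s x Hs. unfold pathB; cbv zeta.
  set (l1 := p1 + s * d1). set (l2 := p2 + s * d2).
  assert (L1 : r1 <= l1 <= p1 + Rabs d1).
  { unfold r1, l1; pose proof (Rmin_l p1 (p1 + d1)); pose proof (Rmin_r p1 (p1 + d1)).
    pose proof (Rle_abs d1); pose proof (Rabs_pos d1); split; nra. }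
  assert (L2 : r2 <= l2 <= p2 + Rabs d2).
  { unfold r2, l2; pose proof (Rmin_l p2 (p2 + d2)); pose proof (Rmin_r p2 (p2 + d2)).
    pose proof (Rle_abs d2); pose proof (Rabs_pos d2); split; nra. }
  set (th := PI * _ + f0).
  set (u := l1 * x + s * e1). set (w := l2 * x + s * e2).
  assert (UW : r1 * r2 * x ^ 2 - C * Rabs x - c <= u * w).
  { replace (u * w) with (l1 * l2 * x ^ 2 + (s * ((l1 * e2 + l2 * e1) * x) + s * s * (e1 * e2)))
      by (unfold u, w; ring).
    assert (T1 : r1 * r2 * x ^ 2 <= l1 * l2 * x ^ 2).
    { apply Rmult_le_compat_r; [apply pow2_ge_0|]. apply Rmult_le_compat; lra. }
    assert (T2 : Rabs ((l1 * e2 + l2 * e1) * x) <= C * Rabs x).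
    { rewrite Rabs_mult. apply Rmult_le_compat_r; [apply Rabs_pos|].
      eapply Rle_trans; [apply Rabs_triang|]. rewrite !Rabs_mult.
      rewrite (Rabs_pos_eq l1), (Rabs_pos_eq l2) by lra.
      unfold C; apply Rplus_le_compat; apply Rmult_le_compat_r; try apply Rabs_pos; lra. }
    assert (T3 : Rabs (e1 * e2) <= c) by (unfold c; rewrite Rabs_mult; lra).
    apply Rabs_le_between in T2, T3.
    assert (T2' : 0 <= C * Rabs x) by lra. assert (T3' : 0 <= c) by lra.
    assert (- (C * Rabs x) <= s * ((l1 * e2 + l2 * e1) * x)) by nra.
    assert (- c <= s * s * (e1 * e2)) by (assert (0 <= s * s <= 1) by nra; nra).
    lra. }
  assert (EB : exp (- (2 * PI * (u * w))) * exp (Rabs x) <= K * exp (- Rabs x)).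
  { rewrite <- exp_plus. eapply Rle_trans; [|apply HK]. apply exp_le_mono. nra. }
  assert (LB : Rabs ((d1 * x + e1) * cos th - (d2 * x + e2) * sin th) <= H * exp (Rabs x)).
  { unfold Rminus. eapply Rle_trans; [apply Rabs_triang|]. rewrite Rabs_Ropp, !Rabs_mult.
    assert (Cb : Rabs (cos th) <= 1) by (apply Rabs_le, COS_bound).
    assert (Sb : Rabs (sin th) <= 1) by (apply Rabs_le, SIN_bound).
    assert (X1 : Rabs (d1 * x + e1) <= Rabs d1 * Rabs x + Rabs e1).
    { eapply Rle_trans; [apply Rabs_triang|]. rewrite Rabs_mult; lra. }
    assert (X2 : Rabs (d2 * x + e2) <= Rabs d2 * Rabs x + Rabs e2).
    { eapply Rle_trans; [apply Rabs_triang|]. rewrite Rabs_mult; lra. }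
    pose proof (Rabs_pos (d1 * x + e1)) as Y1; pose proof (Rabs_pos (d2 * x + e2)) as Y2.
    pose proof (Rabs_pos d1); pose proof (Rabs_pos d2);
    pose proof (Rabs_pos e1); pose proof (Rabs_pos e2); pose proof (Rabs_pos x).
    apply Rle_trans with (Rabs (d1 * x + e1) * 1 + Rabs (d2 * x + e2) * 1).
    { apply Rplus_le_compat; now apply Rmult_le_compat_l. }
    apply Rle_trans with (H * (1 + Rabs x)); [unfold H; nra|].
    apply Rmult_le_compat_l; [assumption|apply exp_ineq1_le]. }
  rewrite Rabs_mult, (Rabs_pos_eq (exp _)) by (left; apply exp_pos).
  apply Rle_trans with (exp (- (2 * PI * (u * w))) * (H * exp (Rabs x))).
  { apply Rmult_le_compat_l; [left; apply exp_pos|exact LB]. }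
  replace (exp (- (2 * PI * (u * w))) * (H * exp (Rabs x))) with
    (H * (exp (- (2 * PI * (u * w))) * exp (Rabs x))) by ring.
  rewrite (Rmult_assoc H). now apply Rmult_le_compat_l.
Qed.

(** The boundary terms at distance m + 1/2 are at most K exp(-m), so the integrals at the two ends
    of the segment have the same limit. *)
Lemma pathA_limit p1 p2 d1 d2 e1 e2 f0 (l : R) :
  0 < p1 -> 0 < p2 -> 0 < p1 + d1 -> 0 < p2 + d2 ->
  is_lim_seq (fun m => RInt (pathA p1 p2 d1 d2 e1 e2 f0 0) (- INR m - 1/2) (INR m + 1/2)) l ->
  is_lim_seq (fun m => RInt (pathA p1 p2 d1 d2 e1 e2 f0 1) (- INR m - 1/2) (INR m + 1/2)) l.
Proof.
  intros P1 P2 Q1 Q2 Hl.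
  destruct (pathB_bound p1 p2 d1 d2 e1 e2 f0 P1 P2 Q1 Q2) as (K & K0 & HK).
  set (A := pathA p1 p2 d1 d2 e1 e2 f0) in *.
  assert (D0 : is_lim_seq (fun m => RInt (A 1) (- INR m - 1/2) (INR m + 1/2) -
     RInt (A 0) (- INR m - 1/2) (INR m + 1/2)) 0).
  { apply is_lim_seq_dominated with (2 * K). intros m. rewrite Rmult_assoc.
    apply (RInt_homotopy A (pathB p1 p2 d1 d2 e1 e2 f0) (pathD p1 p2 d1 d2 e1 e2 f0)).
    - intros; apply is_derive_pathA.
    - intros; apply is_derive_pathB.
    - intros; apply continuity_pathD.
    - intros s x. apply (ex_derive_continuous (A s)). unfold A, pathA; cbv zeta.
      auto_derive; trivial.
    - intros s x. apply (ex_derive_continuous (pathD p1 p2 d1 d2 e1 e2 f0 s)).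
      unfold pathD; cbv zeta. auto_derive; trivial.
    - intros s Hs. pose proof (pos_INR m).
      assert (T : forall x, INR m <= Rabs x ->
         Rabs (pathB p1 p2 d1 d2 e1 e2 f0 s x) <= K * exp (- INR m)).
      { intros x Hx. eapply Rle_trans; [apply HK; assumption|].
        apply Rmult_le_compat_l; [assumption|]. apply exp_le_mono; lra. }
      split; apply T.
      + replace (- INR m - 1/2) with (- (INR m + 1/2)) by ring.
        rewrite Rabs_Ropp, Rabs_pos_eq; lra.
      + rewrite Rabs_pos_eq; lra. }
  replace l with (0 + l) by ring.
  eapply is_lim_seq_ext; [|apply is_lim_seq_plus'; [exact D0|exact Hl]].
  intros m; cbv beta. ring.
Qed.

Lemma continuous_gauss_real (c x : R) : continuous (fun x => exp (- (c * (x * x)))) x.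
Proof. apply (ex_derive_continuous (fun x => exp (- (c * (x * x))))). auto_derive; trivial. Qed.

(** The truncated integrals increase and are bounded by those of 1/(1 + x^2), hence by pi, because
    exp(2 pi x^2) >= 1 + 2 pi x^2. The value is determined later from theta at i. *)
Lemma gauss_real_limit : exists kappa : R,
  is_lim_seq (fun m => RInt (fun x => exp (- (2 * PI * (x * x)))) (- INR m - 1/2) (INR m + 1/2)) kappa.
Proof.
  set (f := fun x => exp (- (2 * PI * (x * x)))).
  assert (Hf : forall x, continuous f x) by (intros; apply continuous_gauss_real).
  assert (X : forall a b, ex_RInt f a b).
  { intros; apply (ex_RInt_continuous (V := R_CompleteNormedModule)); intros; apply Hf. }
  assert (P : forall a b, a <= b -> 0 <= RInt f a b).
  { intros a b Hab; apply RInt_ge_0; [assumption|apply X|]. intros; left; apply exp_pos. }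
  apply (ex_finite_lim_seq_incr _ PI).
  - intros m. rewrite RInt_centered_succ by exact Hf.
    pose proof (P (INR (S m) - 1/2) (INR (S m) + 1/2)).
    pose proof (P (- INR (S m) - 1/2) (- INR (S m) + 1/2)). lra.
  - intros m. set (a := - INR m - 1/2). set (b := INR m + 1/2).
    assert (I : is_RInt (fun x => / (1 + x ^ 2)) a b (minus (atan b) (atan a))).
    { apply (is_RInt_derive (V := R_CompleteNormedModule) atan); intros x _.
      - apply is_derive_Reals, derivable_pt_lim_atan.
      - apply (ex_derive_continuous (fun x => / (1 + x ^ 2))). auto_derive. nra. }
    apply Rle_trans with (RInt (fun x => / (1 + x ^ 2)) a b).
    + apply RInt_le; [unfold a, b; pose proof (pos_INR m); lra|apply X|eexists; apply I|].
      intros x _. unfold f. rewrite exp_Ropp. apply Rinv_le_contravar; [nra|].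
      eapply Rle_trans; [|apply exp_ineq1_le]. pose proof PI2_3_2. nra.
    + rewrite (is_RInt_unique _ _ _ _ I). unfold minus, plus, opp; simpl.
      destruct (atan_bound a), (atan_bound b); lra.
Qed.

Lemma gauss_components (z : C) :
  gauss z = (exp (- (2 * PI * (Re z * Im z))) * cos (PI * (Re z * Re z - Im z * Im z)),
             exp (- (2 * PI * (Re z * Im z))) * sin (PI * (Re z * Re z - Im z * Im z))).
Proof.
  destruct z as [u w]. unfold gauss, cexp; simpl. f_equal; f_equal; f_equal; ring.
Qed.

Lemma gaussian_integral_limit : exists omega : C, forall lam mu : C,
  0 < Re lam -> 0 < Im lam ->
  is_Clim (fun m => CInt (fun x => Cmult lam (gauss (Cplus (Cmult lam (RtoC x)) mu)))
     (- INR m - 1/2) (INR m + 1/2)) omega.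
Proof.
  destruct gauss_real_limit as [k Hk].
  (* The base point is lam = 1 + i, mu = 0: since (1 + i)^2 = 2i, the integrand is (1 + i) exp(-2 pi
     x^2), whose integral tends to k + i k. *)
  exists (k, k). intros [l1 l2] [m1 m2] L1 L2; simpl in L1, L2.
  (* cos f0 - sin f0 is the real part of e^(i f0) (1 + i); the values f0 = 0 and f0 = -pi/2 give the
     real and imaginary parts. *)
  assert (Pr : forall f0, is_lim_seq (fun m => RInt (pathA 1 1 (l1 - 1) (l2 - 1) m1 m2 f0 1)
      (- INR m - 1/2) (INR m + 1/2)) ((cos f0 - sin f0) * k)).
  { intros f0. apply pathA_limit; [lra|lra|lra|lra|].
    eapply is_lim_seq_ext; [|apply is_lim_seq_scal_finite, Hk].
    intros m; cbv beta. rewrite <- RInt_scal_continuous.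
    - apply RInt_ext_all; intros x. unfold pathA; cbv zeta.
      replace ((1 + 0 * (l1 - 1)) * x + 0 * m1) with x by ring.
      replace ((1 + 0 * (l2 - 1)) * x + 0 * m2) with x by ring.
      replace (PI * (x * x - x * x) + f0) with f0 by ring. ring.
    - intros x; apply continuous_gauss_real. }
  assert (E : forall x, (1 + 1 * (l1 - 1)) * x + 1 * m1 = l1 * x - l2 * 0 + m1 /\
                        (1 + 1 * (l2 - 1)) * x + 1 * m2 = l1 * 0 + l2 * x + m2)
    by (intros; split; ring).
  split.
  - pose proof (Pr 0) as H. rewrite cos_0, sin_0 in H.
    replace ((1 - 0) * k) with k in H by ring.
    eapply is_lim_seq_ext; [|exact H]. intros m. rewrite Re_CInt.
    apply RInt_ext_all; intros x. rewrite gauss_components.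
    unfold pathA; cbv zeta. destruct (E x) as [-> ->]. rewrite Rplus_0_r. simpl. ring.
  - pose proof (Pr (- (PI / 2))) as H. rewrite cos_neg, sin_neg, cos_PI2, sin_PI2 in H.
    replace ((0 - - (1)) * k) with k in H by ring.
    eapply is_lim_seq_ext; [|exact H]. intros m. rewrite Im_CInt.
    apply RInt_ext_all; intros x. rewrite gauss_components.
    unfold pathA; cbv zeta. destruct (E x) as [-> ->].
    rewrite cos_plus, sin_plus, cos_neg, sin_neg, cos_PI2, sin_PI2. simpl. ring.
Qed.

(** * Inversion of theta constants *)

Definition epi (z : C) : C := cexp (Cmult (Cmult (RtoC PI) Ci) z).

Lemma cexp_plus (z w : C) : cexp (Cplus z w) = Cmult (cexp z) (cexp w).
Proof.
  destruct z as [a b], w as [c d]; unfold cexp; simpl.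
  rewrite exp_plus, cos_plus, sin_plus; unfold Cmult; simpl; f_equal; ring.
Qed.

Lemma epi_plus (z w : C) : epi (Cplus z w) = Cmult (epi z) (epi w).
Proof. unfold epi. rewrite <- cexp_plus. f_equal; ring. Qed.

Lemma epi_components (z : C) :
  epi z = (exp (- (PI * Im z)) * cos (PI * Re z), exp (- (PI * Im z)) * sin (PI * Re z)).
Proof.
  destruct z as [u w]; unfold epi, cexp; simpl. f_equal; f_equal; f_equal; ring.
Qed.

Lemma epi_0 : epi (RtoC 0) = RtoC 1.
Proof.
  rewrite epi_components; simpl. rewrite Rmult_0_r, Ropp_0, exp_0, cos_0, sin_0.
  unfold RtoC; f_equal; ring.
Qed.

Lemma Cmod_epi (z : C) : Cmod (epi z) = exp (- (PI * Im z)).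
Proof.
  rewrite epi_components; unfold Cmod; simpl fst; simpl snd.
  set (r := exp _). set (t := PI * Re z).
  replace ((r * cos t) ^ 2 + (r * sin t) ^ 2) with (r ^ 2 * (Rsqr (sin t) + Rsqr (cos t)))
    by (unfold Rsqr; ring).
  rewrite sin2_cos2, Rmult_1_r. apply sqrt_pow2. left; apply exp_pos.
Qed.

(* General term of the theta series with characteristic [(2p, 2q)], extended to real [x]. *)
Definition gterm (p q : R) (tau : C) (x : R) : C :=
  epi (Cplus (Cmult (RtoC ((x + p) ^ 2)) tau) (RtoC (2 * (x + p) * q))).

Definition th (p q : R) (tau : C) : C := zsum (fun n => gterm p q tau (IZR n)).

Lemma zsum_ext (f g : Z -> C) : (forall n, f n = g n) -> zsum f = zsum g.
Proof.
  intros H; unfold zsum; f_equal; f_equal; apply Lim_seq_ext; intros N;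
    now rewrite (zpartial_ext f g N H).
Qed.

Lemma theta_th (e e' : R) (tau : C) : theta e e' (RtoC 0) tau = th (e / 2) (e' / 2) tau.
Proof.
  apply zsum_ext; intros n; cbv zeta. unfold gterm, epi. f_equal.
  set (r := IZR n + e / 2). apply C_eq; destruct tau; simpl; field.
Qed.

(** One majorant serves twice: the summand 1 dominates [gterm] itself, and the remaining factor
    dominates its derivative, since the logarithmic derivative of [gterm] in x is 2 pi i ((x + p)
    tau + q). *)
Lemma gterm_bound (p q : R) (tau : C) : 0 < Im tau ->
  exists K, 0 <= K /\ forall x, (2 * PI * (Rabs (Re tau) + Im tau + Rabs q) * (1 + Rabs (x + p)) + 1) *
     exp (- (PI * ((x + p) ^ 2 * Im tau))) <= K * exp (- Rabs x).
Proof.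
  intros Ht. pose proof PI_RGT_0 as P0.
  set (H := 2 * PI * (Rabs (Re tau) + Im tau + Rabs q)).
  assert (H0 : 0 <= H).
  { unfold H; pose proof (Rabs_pos (Re tau)); pose proof (Rabs_pos q).
    apply Rmult_le_pos; lra. }
  destruct (gauss_tail (PI * Im tau) (2 * PI * Im tau * Rabs p + 1) (Rabs p)) as (K & K0 & HK).
  { now apply Rmult_lt_0_compat. }
  exists ((H + 1) * K); split; [apply Rmult_le_pos; lra|]. intros x.
  apply Rle_trans with ((H + 1) * exp (Rabs x + Rabs p) * exp (- (PI * ((x + p) ^ 2 * Im tau)))).
  { apply Rmult_le_compat_r; [left; apply exp_pos|].
    pose proof (Rabs_triang x p). pose proof (Rabs_pos (x + p)).
    pose proof (exp_ineq1_le (Rabs x + Rabs p)). nra. }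
  rewrite !Rmult_assoc. apply Rmult_le_compat_l; [lra|].
  rewrite <- exp_plus. eapply Rle_trans; [|apply HK]. apply exp_le_mono.
  assert (T : - (2 * Rabs p * Rabs x) <= 2 * (x * p)).
  { pose proof (Rle_abs (- (x * p))) as T. rewrite Rabs_Ropp, Rabs_mult in T. lra. }
  assert (0 <= p ^ 2) by apply pow2_ge_0.
  assert (W : 0 < PI * Im tau) by now apply Rmult_lt_0_compat.
  replace (PI * ((x + p) ^ 2 * Im tau)) with (PI * Im tau * (x ^ 2 + 2 * (x * p) + p ^ 2)) by ring.
  set (v := PI * Im tau) in *.
  replace (2 * PI * Im tau * Rabs p) with (2 * v * Rabs p) by (unfold v; ring).
  nra.
Qed.

Lemma exp_decay_gterm (p q : R) (tau : C) : 0 < Im tau ->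
  exp_decay (fun n => gterm p q tau (IZR n)).
Proof.
  intros Ht. destruct (gterm_bound p q tau Ht) as (K & K0 & HK).
  exists K; intros n. unfold gterm; rewrite Cmod_epi.
  eapply Rle_trans; [|apply HK].
  replace (Im _) with ((IZR n + p) ^ 2 * Im tau) by (destruct tau; simpl; ring).
  rewrite <- (Rmult_1_l (exp _)) at 1. apply Rmult_le_compat_r; [left; apply exp_pos|].
  pose proof PI_RGT_0; pose proof (Rabs_pos (Re tau)); pose proof (Rabs_pos q);
    pose proof (Rabs_pos (IZR n + p)).
  assert (0 <= 2 * PI * (Rabs (Re tau) + Im tau + Rabs q) * (1 + Rabs (IZR n + p))).
  { apply Rmult_le_pos; [apply Rmult_le_pos|]; lra. }
  lra.
Qed.

Lemma is_zsum_th (p q : R) (tau : C) : 0 < Im tau ->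
  is_zsum (fun n => gterm p q tau (IZR n)) (th p q tau).
Proof.
  intros Ht. destruct (ex_zsum _ (exp_decay_gterm p q tau Ht)) as [l Hl].
  unfold th; now rewrite (is_zsum_unique _ _ Hl).
Qed.

(* Real part of [gterm] for [f0 = 0], imaginary part for [f0 = - PI / 2]. *)
Definition gphase (p q t1 t2 f0 x : R) : R :=
  exp (- (PI * (((x + p) * (x + p)) * t2))) * cos (PI * (((x + p) * (x + p)) * t1 + 2 * (x + p) * q) + f0).

Lemma Re_gterm (p q : R) (tau : C) (x : R) :
  Re (gterm p q tau x) = gphase p q (Re tau) (Im tau) 0 x.
Proof.
  unfold gterm, gphase; rewrite epi_components; destruct tau as [t1 t2]; simpl.
  f_equal; f_equal; ring.
Qed.

Lemma Im_gterm (p q : R) (tau : C) (x : R) :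
  Im (gterm p q tau x) = gphase p q (Re tau) (Im tau) (- (PI / 2)) x.
Proof.
  unfold gterm, gphase. rewrite epi_components, cos_plus, cos_neg, sin_neg, cos_PI2, sin_PI2.
  set (z := Cplus _ _).
  replace (Re z) with (((x + p) * (x + p)) * Re tau + 2 * (x + p) * q) by (destruct tau; simpl; ring).
  replace (Im z) with (((x + p) * (x + p)) * Im tau) by (destruct tau; simpl; ring).
  clear z; set (e := exp _); set (t := PI * (_ + _)). simpl. ring.
Qed.

Lemma gphase_lipschitz (p q t1 t2 f0 : R) : 0 < t2 ->
  exists K, 0 <= K /\ forall (n : Z) x, Rabs (x - IZR n) <= 1/2 ->
     Rabs (gphase p q t1 t2 f0 x - gphase p q t1 t2 f0 (IZR n)) <=
       K * exp (- Rabs (IZR n)) * Rabs (x - IZR n).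
Proof.
  intros Ht. destruct (gterm_bound p q (t1, t2) Ht) as (K & K0 & HK); simpl in HK.
  (* The mean value point c satisfies |c| >= |n| - 1/2, which costs exp(1/2). *)
  exists (K * exp (1/2)); split; [apply Rmult_le_pos; [assumption|left; apply exp_pos]|].
  intros n x Hx.
  set (df := fun x => exp (- (PI * (((x + p) * (x + p)) * t2))) *
    (- (PI * (2 * (x + p) * t2)) * cos (PI * (((x + p) * (x + p)) * t1 + 2 * (x + p) * q) + f0) -
     PI * (2 * (x + p) * t1 + 2 * q) * sin (PI * (((x + p) * (x + p)) * t1 + 2 * (x + p) * q) + f0))).
  destruct (MVT_cor4 (gphase p q t1 t2 f0) df (IZR n) (1/2)) with (b := x) as (c & E & Hc).
  { intros c _. unfold gphase, df, Rminus. auto_derive; [trivial|]. ring. }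
  { exact Hx. }
  rewrite E, Rabs_mult. apply Rmult_le_compat_r; [apply Rabs_pos|].
  apply Rle_trans with (K * exp (- Rabs c)).
  - eapply Rle_trans; [|apply HK]. unfold df.
    rewrite Rabs_mult, (Rabs_pos_eq (exp _)) by (left; apply exp_pos).
    replace ((c + p) * ((c + p) * 1)) with ((c + p) * (c + p)) by ring.
    rewrite Rmult_comm. apply Rmult_le_compat_r; [left; apply exp_pos|].
    set (u := PI * _ + f0). pose proof PI_RGT_0 as P0.
    assert (Cb : Rabs (cos u) <= 1) by (apply Rabs_le, COS_bound).
    assert (Sb : Rabs (sin u) <= 1) by (apply Rabs_le, SIN_bound).
    unfold Rminus. eapply Rle_trans; [apply Rabs_triang|].
    rewrite Rabs_Ropp, !(Rabs_mult _ (cos u)), (Rabs_mult _ (sin u)).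
    set (Y := Rabs (c + p)). assert (Y0 : 0 <= Y) by apply Rabs_pos.
    assert (X1 : Rabs (- (PI * (2 * (c + p) * t2))) <= 2 * PI * t2 * Y).
    { rewrite Rabs_Ropp, !Rabs_mult, (Rabs_pos_eq PI), (Rabs_pos_eq 2), (Rabs_pos_eq t2) by lra.
      fold Y; right; ring. }
    assert (X2 : Rabs (PI * (2 * (c + p) * t1 + 2 * q)) <= 2 * PI * (Rabs t1 * Y + Rabs q)).
    { rewrite Rabs_mult, (Rabs_pos_eq PI) by lra.
      replace (2 * PI * (Rabs t1 * Y + Rabs q)) with (PI * (2 * Y * Rabs t1 + 2 * Rabs q)) by ring.
      apply Rmult_le_compat_l; [lra|]. eapply Rle_trans; [apply Rabs_triang|].
      rewrite !Rabs_mult, !(Rabs_pos_eq 2) by lra. fold Y; lra. }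
    apply Rle_trans with (Rabs (- (PI * (2 * (c + p) * t2))) * 1 + Rabs (PI * (2 * (c + p) * t1 + 2 * q)) * 1).
    { apply Rplus_le_compat; apply Rmult_le_compat_l; auto using Rabs_pos. }
    pose proof (Rabs_pos t1) as A1; pose proof (Rabs_pos q) as A2.
    assert (0 <= PI * (t2 + Rabs t1)) by (apply Rmult_le_pos; lra).
    assert (0 <= PI * (Rabs q * Y)) by (apply Rmult_le_pos; [lra|now apply Rmult_le_pos]).
    replace (2 * PI * (Rabs t1 + t2 + Rabs q) * (1 + Y) + 1) with
      (2 * PI * t2 * Y + 2 * PI * (Rabs t1 * Y + Rabs q) +
        2 * (PI * (t2 + Rabs t1)) + 2 * (PI * (Rabs q * Y)) + 1) by ring.
    lra.
  - rewrite Rmult_assoc, <- exp_plus. apply Rmult_le_compat_l; [assumption|].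
    apply exp_le_mono.
    pose proof (Rabs_triang_inv (IZR n) c) as T. rewrite Rabs_minus_sym in T.
    lra.
Qed.

Lemma continuous_gphase (p q t1 t2 f0 x : R) : continuous (gphase p q t1 t2 f0) x.
Proof.
  apply (ex_derive_continuous (gphase p q t1 t2 f0)). unfold gphase. auto_derive; trivial.
Qed.

Lemma continuous_Re_gterm p q tau x : continuous (fun x => Re (gterm p q tau x)) x.
Proof.
  apply continuous_ext with (gphase p q (Re tau) (Im tau) 0);
   [intros; symmetry; apply Re_gterm|apply continuous_gphase].
Qed.

Lemma continuous_Im_gterm p q tau x : continuous (fun x => Im (gterm p q tau x)) x.
Proof.
  apply continuous_ext with (gphase p q (Re tau) (Im tau) (- (PI / 2)));
   [intros; symmetry; apply Im_gterm|apply continuous_gphase].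
Qed.

Lemma CInt_scal (c : C) (f : R -> C) (a b : R) :
  (forall x, continuous (fun x => Re (f x)) x) -> (forall x, continuous (fun x => Im (f x)) x) ->
  CInt (fun x => Cmult c (f x)) a b = Cmult c (CInt f a b).
Proof.
  intros H1 H2.
  assert (L : forall k1 k2, RInt (fun x => k1 * Re (f x) + k2 * Im (f x)) a b =
     k1 * RInt (fun x => Re (f x)) a b + k2 * RInt (fun x => Im (f x)) a b).
  { intros k1 k2. rewrite <- !RInt_scal_continuous, <- RInt_plus_continuous; auto;
      intros x; apply (continuous_scal_r (V := R_NormedModule)); auto. }
  apply C_eq.
  - rewrite Re_CInt. transitivity (RInt (fun x => Re c * Re (f x) + - Im c * Im (f x)) a b).
    + apply RInt_ext_all; intros x; destruct c, (f x); simpl; ring.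
    + rewrite L; destruct c; simpl; ring.
  - rewrite Im_CInt. transitivity (RInt (fun x => Im c * Re (f x) + Re c * Im (f x)) a b).
    + apply RInt_ext_all; intros x; destruct c, (f x); simpl; ring.
    + rewrite L; destruct c; simpl; ring.
Qed.

Lemma exists_sqrt_first_quadrant (tau : C) : 0 < Im tau ->
  exists lam : C, 0 < Re lam /\ 0 < Im lam /\ Cmult lam lam = tau.
Proof.
  destruct tau as [t1 t2]; simpl; intros Ht.
  set (r := sqrt (t1 ^ 2 + t2 ^ 2)).
  assert (R0 : 0 <= r) by apply sqrt_pos.
  assert (R2 : r * r = t1 ^ 2 + t2 ^ 2) by (apply sqrt_sqrt; nra).
  assert (RT : 0 < r + t1) by nra.
  set (a := sqrt ((r + t1) / 2)).
  assert (A0 : 0 < a) by (apply sqrt_lt_R0; lra).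
  assert (A2 : a * a = (r + t1) / 2) by (apply sqrt_sqrt; lra).
  exists (a, t2 / (2 * a)); simpl; repeat split; [assumption| |].
  - apply Rdiv_lt_0_compat; lra.
  - unfold Cmult; simpl; f_equal; [|field; lra].
    replace (t2 / (2 * a) * (t2 / (2 * a))) with (t2 ^ 2 / (4 * (a * a))) by (field; lra).
    rewrite A2. replace (t2 ^ 2) with (r * r - t1 ^ 2) by lra. field; lra.
Qed.

Lemma Im_neg_inv_pos (tau : C) : 0 < Im tau -> 0 < Im (Copp (Cinv tau)).
Proof.
  destruct tau as [t1 t2]; simpl; intros Ht.
  replace (- (- t2 / (t1 * (t1 * 1) + t2 * (t2 * 1)))) with (t2 / (t1 * t1 + t2 * t2)) by (field; nra).
  apply Rdiv_lt_0_compat; nra.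
Qed.

Lemma Im_pos_neq_0 (tau : C) : 0 < Im tau -> tau <> RtoC 0.
Proof. intros H E; rewrite E in H; simpl in H; lra. Qed.

Lemma C_neq_0_of_sq (lam tau : C) : Cmult lam lam = tau -> tau <> RtoC 0 -> lam <> RtoC 0.
Proof. intros H H0 E; apply H0; rewrite <- H, E; ring. Qed.

(** The square of lam (x + p) + y / lam is (x + p)^2 tau + 2 (x + p) y + y^2 / tau. *)
Lemma gterm_complete_square (p y : R) (tau lam : C) (x : R) :
  Cmult lam lam = tau -> lam <> RtoC 0 ->
  gauss (Cplus (Cmult lam (RtoC x)) (Cplus (Cmult lam (RtoC p)) (Cdiv (RtoC y) lam))) =
  Cmult (epi (Cdiv (RtoC (y ^ 2)) tau)) (gterm p y tau x).
Proof.
  intros Hl L0. change gauss with (fun z => epi (Cmult z z)); cbv beta.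
  unfold gterm. rewrite <- epi_plus. f_equal. rewrite <- Hl.
  simpl pow. rewrite !RtoC_mult, !RtoC_plus. field. exact L0.
Qed.

Lemma rpartial_Re (f : R -> C) (m : nat) :
  rpartial (fun x => Re (f x)) m = Re (zpartial (fun n => f (IZR n)) m).
Proof.
  induction m as [|m IH]; [reflexivity|].
  cbn [rpartial zpartial]. rewrite IH, opp_IZR, <- INR_IZR_INZ. reflexivity.
Qed.

Lemma rpartial_Im (f : R -> C) (m : nat) :
  rpartial (fun x => Im (f x)) m = Im (zpartial (fun n => f (IZR n)) m).
Proof.
  induction m as [|m IH]; [reflexivity|].
  cbn [rpartial zpartial]. rewrite IH, opp_IZR, <- INR_IZR_INZ. reflexivity.
Qed.

(** Multiplying by cos(2 pi k x) is averaging the modulations by k and -k, so the cosine form of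
    Poisson summation applies to each real projection of a complex [f]. It serves for [Re] and
    [Im]. *)
Lemma poisson_projection (pr : C -> R) (f : R -> C) (fh : Z -> C) (K : R) (G l : R) :
  (forall z w, pr (Cplus z w) = pr z + pr w) ->
  (forall (r : R) z, pr (Cmult (RtoC r) z) = r * pr z) ->
  (forall x, continuous (fun x => pr (f x)) x) -> 0 <= K ->
  (forall (n : Z) x, Rabs (x - IZR n) <= 1/2 ->
     Rabs (pr (f x) - pr (f (IZR n))) <= K * exp (- Rabs (IZR n)) * Rabs (x - IZR n)) ->
  (forall (k : Z) x, continuous (fun x => pr (Cmult (f x) (epi (RtoC (2 * IZR k * x))))) x) ->
  (forall k : Z, is_lim_seq (fun m => RInt (fun x => pr (Cmult (f x) (epi (RtoC (2 * IZR k * x)))))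
       (- INR m - 1/2) (INR m + 1/2)) (pr (fh k))) ->
  is_lim_seq (rpartial (fun x => pr (f x))) G ->
  is_lim_seq (fun N => pr (zpartial fh N)) l -> G = l.
Proof.
  intros Hadd Hscal Hc HK HL Hce Hh HG Hl.
  apply (poisson_summation_even (fun x => pr (f x)) K
    (fun k => (pr (fh (Z.of_nat k)) + pr (fh (- Z.of_nat k)%Z)) / 2)
    (fun N => pr (zpartial fh N))); try assumption.
  - intros k.
    assert (E : forall x, pr (f x) * cos (2 * PI * INR k * x) =
       / 2 * (pr (Cmult (f x) (epi (RtoC (2 * IZR (Z.of_nat k) * x)))) +
              pr (Cmult (f x) (epi (RtoC (2 * IZR (- Z.of_nat k) * x)))))).
    { intros x. rewrite <- Hadd, opp_IZR, <- INR_IZR_INZ.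
      replace (Cplus _ _) with (Cmult (RtoC (2 * cos (2 * PI * INR k * x))) (f x)).
      - rewrite Hscal; field.
      - rewrite !epi_components; simpl. rewrite !Rmult_0_r, !Ropp_0, exp_0.
        replace (PI * (2 * - INR k * x)) with (- (PI * (2 * INR k * x))) by ring.
        rewrite cos_neg, sin_neg.
        replace (2 * PI * INR k * x) with (PI * (2 * INR k * x)) by ring.
        destruct (f x); unfold Cmult, Cplus; simpl; f_equal; ring. }
    eapply is_lim_seq_ext; [|replace ((pr (fh (Z.of_nat k)) + pr (fh (- Z.of_nat k)%Z)) / 2)
      with (/ 2 * (pr (fh (Z.of_nat k)) + pr (fh (- Z.of_nat k)%Z))) by field;
      apply is_lim_seq_scal_finite, is_lim_seq_plus'; [apply Hh|apply Hh]].
    intros m; cbv beta. rewrite <- RInt_plus_continuous by apply Hce.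
    rewrite <- RInt_scal_continuous.
    + apply RInt_ext_all; intros x; symmetry; apply E.
    + intros x.
      apply (continuous_plus (fun x => pr (Cmult (f x) (epi (RtoC (2 * IZR (Z.of_nat k) * x)))))
       (fun x => pr (Cmult (f x) (epi (RtoC (2 * IZR (- Z.of_nat k) * x)))))); apply Hce.
  - simpl. field.
  - intros k. cbn [zpartial]. rewrite (Hadd (zpartial fh k)), Hadd. field.
Qed.

Lemma gterm_modulate (p q : R) (tau : C) (k : Z) (x : R) :
  Cmult (gterm p q tau x) (epi (RtoC (2 * IZR k * x))) =
  Cmult (epi (RtoC (- (2 * IZR k * p)))) (gterm p (q + IZR k) tau x).
Proof.
  unfold gterm. rewrite <- !epi_plus. f_equal.
  rewrite <- !Cplus_assoc, (Cplus_comm (RtoC (- _))), <- Cplus_assoc. f_equal.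
  rewrite <- !RtoC_plus. f_equal. ring.
Qed.

Lemma continuous_lin_comb (f : R -> C) (c : C) x :
  (forall x, continuous (fun x => Re (f x)) x) -> (forall x, continuous (fun x => Im (f x)) x) ->
  continuous (fun x => Re (Cmult c (f x))) x /\ continuous (fun x => Im (Cmult c (f x))) x.
Proof.
  intros H1 H2; destruct c as [c1 c2]; simpl; split.
  - apply (continuous_minus (V := R_NormedModule) (fun x => c1 * Re (f x)) (fun x => c2 * Im (f x)));
      apply (continuous_scal_r (V := R_NormedModule)); auto.
  - apply (continuous_plus (V := R_NormedModule) (fun x => c1 * Im (f x)) (fun x => c2 * Re (f x)));
      apply (continuous_scal_r (V := R_NormedModule)); auto.
Qed.

Lemma epi_opp (z : C) : Cmult (epi (Copp z)) (epi z) = RtoC 1.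
Proof. rewrite <- epi_plus, <- epi_0; f_equal; ring. Qed.

Lemma gterm_integral_limit (omega tau lam : C) (p y : R) :
  (forall mu : C, is_Clim (fun m => CInt (fun x => Cmult lam (gauss (Cplus (Cmult lam (RtoC x)) mu)))
     (- INR m - 1/2) (INR m + 1/2)) omega) ->
  Cmult lam lam = tau -> lam <> RtoC 0 ->
  is_Clim (fun m => CInt (gterm p y tau) (- INR m - 1/2) (INR m + 1/2))
    (Cmult (Cmult (epi (Copp (Cdiv (RtoC (y ^ 2)) tau))) (Cinv lam)) omega).
Proof.
  intros Ho Hl L0.
  eapply is_Clim_ext; [|apply is_Clim_scal, (Ho (Cplus (Cmult lam (RtoC p)) (Cdiv (RtoC y) lam)))].
  intros m; cbv beta.
  replace (CInt _ _ _) with (Cmult (Cmult lam (epi (Cdiv (RtoC (y ^ 2)) tau)))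
     (CInt (gterm p y tau) (- INR m - 1/2) (INR m + 1/2))).
  - pose proof (epi_opp (Cdiv (RtoC (y ^ 2)) tau)) as E.
    revert E; generalize (epi (Copp (Cdiv (RtoC (y ^ 2)) tau))), (epi (Cdiv (RtoC (y ^ 2)) tau)),
      (CInt (gterm p y tau) (- INR m - 1/2) (INR m + 1/2)); intros e1 e2 I E.
    transitivity (Cmult (Cmult e1 e2) I); [field; exact L0|rewrite E; ring].
  - rewrite <- (CInt_scal _ _ _ _ (continuous_Re_gterm p y tau) (continuous_Im_gterm p y tau)).
    apply C_eq; rewrite ?Re_CInt, ?Im_CInt; apply RInt_ext_all; intros x;
      rewrite (gterm_complete_square p y tau lam x Hl L0), Cmult_assoc; reflexivity.
Qed.

Lemma th_inversion_aux (omega tau lam : C) (p q : R) :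
  (forall mu : C, is_Clim (fun m => CInt (fun x => Cmult lam (gauss (Cplus (Cmult lam (RtoC x)) mu)))
     (- INR m - 1/2) (INR m + 1/2)) omega) ->
  Cmult lam lam = tau -> 0 < Im tau ->
  th p q tau = Cmult (Cmult (Cdiv omega lam) (epi (RtoC (2 * p * q)))) (th q (- p) (Copp (Cinv tau))).
Proof.
  intros Ho Hl Ht.
  assert (T0 := Im_pos_neq_0 _ Ht). assert (L0 := C_neq_0_of_sq _ _ Hl T0).
  assert (Ht' := Im_neg_inv_pos _ Ht).
  set (c := Cmult (Cdiv omega lam) (epi (RtoC (2 * p * q)))).
  set (fh := fun k : Z => Cmult c (gterm q (- p) (Copp (Cinv tau)) (IZR k))).
  assert (Sh : is_zsum fh (Cmult c (th q (- p) (Copp (Cinv tau))))) by (apply is_zsum_scal, is_zsum_th, Ht').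
  assert (Sg := is_zsum_th p q tau Ht).
  assert (Lim : forall k : Z, is_Clim (fun m => CInt (fun x => Cmult (gterm p q tau x) (epi (RtoC (2 * IZR k * x))))
      (- INR m - 1/2) (INR m + 1/2)) (fh k)).
  { intros k.
    (* Modulation by the frequency k shifts q to q + k, and the Gaussian integral then produces
       exp(-pi i (q + k)^2 / tau): up to constant phases this is the term of index k of the theta
       series at -1/tau. *)
    replace (fh k) with (Cmult (epi (RtoC (- (2 * IZR k * p))))
       (Cmult (Cmult (epi (Copp (Cdiv (RtoC ((q + IZR k) ^ 2)) tau))) (Cinv lam)) omega)).
    - eapply is_Clim_ext; [|apply is_Clim_scal, (gterm_integral_limit omega tau lam p (q + IZR k) Ho Hl L0)].
      intros m; cbv beta.
      rewrite <- (CInt_scal _ _ _ _ (continuous_Re_gterm p (q + IZR k) tau)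
        (continuous_Im_gterm p (q + IZR k) tau)).
      apply C_eq; rewrite ?Re_CInt, ?Im_CInt; apply RInt_ext_all; intros x;
        rewrite gterm_modulate; reflexivity.
    - unfold fh, c, gterm.
      set (e1 := epi (RtoC (- _))). set (e2 := epi (Copp _)).
      set (e3 := epi (RtoC _)). set (e4 := epi _).
      assert (E : Cmult e1 e2 = Cmult e3 e4).
      { unfold e1, e2, e3, e4. rewrite <- !epi_plus. f_equal.
        replace (2 * (IZR k + q) * - p) with (- (2 * IZR k * p) - 2 * p * q) by ring.
        unfold Rminus. rewrite !RtoC_plus, !RtoC_opp.
        replace ((q + IZR k) ^ 2) with ((IZR k + q) ^ 2) by ring. field. exact T0. }
      transitivity (Cmult (Cmult e1 e2) (Cdiv omega lam)); [field; exact L0|].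
      rewrite E. ring. }
  assert (CR : forall k x, continuous (fun x => Re (Cmult (gterm p q tau x) (epi (RtoC (2 * IZR k * x))))) x
      /\ continuous (fun x => Im (Cmult (gterm p q tau x) (epi (RtoC (2 * IZR k * x))))) x).
  { intros k x.
    destruct (continuous_lin_comb (gterm p (q + IZR k) tau) (epi (RtoC (- (2 * IZR k * p)))) x) as [C1 C2];
      [intros; apply continuous_Re_gterm|intros; apply continuous_Im_gterm|].
    split; [eapply continuous_ext; [|exact C1]|eapply continuous_ext; [|exact C2]];
      intros; cbv beta; now rewrite gterm_modulate. }
  destruct Sh as [Sh1 Sh2], Sg as [Sg1 Sg2].
  apply C_eq.
  - destruct (gphase_lipschitz p q (Re tau) (Im tau) 0 Ht) as (K & K0 & HK).
    apply (poisson_projection Re (gterm p q tau) fh K); auto.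
    + intros r [a b]; simpl; ring.
    + intros; apply continuous_Re_gterm.
    + intros n x Hx; rewrite !Re_gterm; now apply HK.
    + intros k x; exact (proj1 (CR k x)).
    + intros k; exact (proj1 (Lim k)).
    + eapply is_lim_seq_ext; [|exact Sg1]. intros N; symmetry; apply rpartial_Re.
  - destruct (gphase_lipschitz p q (Re tau) (Im tau) (- (PI / 2)) Ht) as (K & K0 & HK).
    apply (poisson_projection Im (gterm p q tau) fh K); auto.
    + intros r [a b]; simpl; ring.
    + intros; apply continuous_Im_gterm.
    + intros n x Hx; rewrite !Im_gterm; now apply HK.
    + intros k x; exact (proj2 (CR k x)).
    + intros k; exact (proj2 (Lim k)).
    + eapply is_lim_seq_ext; [|exact Sg2]. intros N; symmetry; apply rpartial_Im.
Qed.

(** At tau = i with zero characteristic all terms are positive reals, and the one of index 0 is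
    1. *)
Lemma th_i_neq_0 : th 0 0 Ci <> RtoC 0.
Proof.
  assert (H : 0 < Im Ci) by (simpl; lra).
  destruct (is_zsum_th 0 0 Ci H) as [Sg _].
  assert (G : forall n : Z, 0 <= Re (gterm 0 0 Ci (IZR n))).
  { intros n; rewrite Re_gterm; unfold gphase; simpl.
    replace (PI * _ + 0) with 0 by ring. rewrite cos_0, Rmult_1_r. left; apply exp_pos. }
  assert (G0 : Re (gterm 0 0 Ci 0) = 1).
  { rewrite Re_gterm; unfold gphase; simpl.
    replace (PI * (_ + _ * 0) + 0) with 0 by ring.
    replace (- (PI * _)) with 0 by ring. rewrite cos_0, exp_0; ring. }
  assert (L : Rbar_le 1 (Re (th 0 0 Ci))).
  { eapply is_lim_seq_le; [|apply is_lim_seq_const|exact Sg].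
    induction n as [|n IH]; [right; symmetry; exact G0|].
    cbn [zpartial].
    pose proof (G (Z.of_nat (S n))) as G1; pose proof (G (- Z.of_nat (S n))%Z) as G2.
    unfold Re in *; cbn [Cplus fst] in *. lra. }
  change (1 <= Re (th 0 0 Ci)) in L. intros E; rewrite E in L; simpl in L; lra.
Qed.

(** Only the square of [c] is pinned down. Since the same [c] serves all characteristics, a product
    of two theta constants transforms without a choice of root. *)
Lemma th_inversion (tau : C) : 0 < Im tau ->
  exists c : C, Cmult c c = Copp (Cmult Ci tau) /\
  forall p q, th p q (Copp (Cinv tau)) = Cmult (Cmult c (epi (RtoC (2 * p * q)))) (th q (- p) tau).
Proof.
  intros Ht. destruct gaussian_integral_limit as [omega Ho].
  assert (O2 : Cmult omega omega = Ci).
  { assert (Hi : 0 < Im Ci) by (simpl; lra).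
    destruct (exists_sqrt_first_quadrant Ci Hi) as (lam & L1 & L2 & L).
    assert (Ci0 := Im_pos_neq_0 _ Hi). assert (L0 := C_neq_0_of_sq _ _ L Ci0).
    (* The point i is fixed by tau -> -1/tau, so the formula relates the value at i to itself;
       dividing by this nonzero value gives omega = lam, a square root of i. *)
    pose proof (th_inversion_aux omega Ci lam 0 0 (fun mu => Ho lam mu L1 L2) L Hi) as E.
    rewrite Ropp_0, Rmult_0_r, epi_0 in E.
    replace (Copp (Cinv Ci)) with Ci in E
      by (unfold Copp, Cinv, Ci; simpl; f_equal; field).
    assert (W : omega = lam).
    { pose proof th_i_neq_0 as N. set (t := th 0 0 Ci) in *.
      assert (E' : Cmult t lam = Cmult t omega).
      { rewrite E at 1. field. exact L0. }
      transitivity (Cdiv (Cmult t omega) t); [field; exact N|rewrite <- E'; field; exact N]. }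
    now rewrite W. }
  assert (Ht' := Im_neg_inv_pos _ Ht). assert (T0 := Im_pos_neq_0 _ Ht).
  destruct (exists_sqrt_first_quadrant _ Ht') as (lam & L1 & L2 & L).
  assert (L0 := C_neq_0_of_sq _ _ L (Im_pos_neq_0 _ Ht')).
  exists (Cdiv omega lam); split.
  - transitivity (Cdiv (Cmult omega omega) (Cmult lam lam)); [field; exact L0|].
    rewrite O2, L. field. exact T0.
  - intros p q.
    (* The auxiliary formula is applied at -1/tau with lam^2 = -1/tau, hence c^2 = omega^2 / lam^2 =
       -i tau. *)
    rewrite (th_inversion_aux omega _ lam p q (fun mu => Ho lam mu L1 L2) L Ht').
    replace (Copp (Cinv (Copp (Cinv tau)))) with tau; [reflexivity|].
    field. exact T0.
Qed.

(** * Modular transformations *)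

Lemma In_mem_seq (p : nat) (s : list nat) : In p s -> seq.mem_seq s p = true.
Proof.
  induction s as [|x s IH]; simpl; [easy|]. intros [->|H].
  - now rewrite eqtype.eq_refl.
  - rewrite (IH H). now destruct (eqtype.eq_op p x).
Qed.

Lemma In_primes (p n : nat) :
  In p (prime.primes n) -> (1 < p)%nat /\ (Z.of_nat p | Z.of_nat n)%Z.
Proof.
  intros H%In_mem_seq.
  pose proof (prime.mem_primes p n) as E.
  change (ssrbool.in_mem _ _) with (seq.mem_seq (prime.primes n) p) in E. rewrite H in E.
  symmetry in E. apply Bool.andb_true_iff in E as [E1 E2]. apply Bool.andb_true_iff in E2 as [_ E2].
  split.
  - apply prime.prime_gt1 in E1. now apply (ssrbool.elimT ssrnat.leP) in E1.
  - apply (ssrbool.elimT div.dvdnP) in E2 as [k ->].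
    exists (Z.of_nat k). rewrite <- ssrnat.multE. lia.
Qed.

Lemma legendre_unit (a : Z) (p : nat) :
  (a mod Z.of_nat p <> 0)%Z -> legendre a p = 1%Z \/ legendre a p = (-1)%Z.
Proof.
  intros H; unfold legendre. apply Z.eqb_neq in H; rewrite H.
  destruct (existsb _ _); auto.
Qed.

Lemma unit_pow (x : Z) (n : nat) :
  x = 1%Z \/ x = (-1)%Z -> (x ^ Z.of_nat n = 1 \/ x ^ Z.of_nat n = -1)%Z.
Proof.
  intros H; induction n as [|n IH]; [auto|].
  rewrite Nat2Z.inj_succ, Z.pow_succ_r by lia.
  destruct H as [-> | ->], IH as [-> | ->]; auto.
Qed.

(** A prime dividing n cannot divide a, so no Legendre factor vanishes. The sign itself will
    disappear in an even power. *)
Lemma jacobi_unit (a : Z) (n : nat) : (0 < n)%nat -> Z.gcd a (Z.of_nat n) = 1%Z ->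
  jacobi a n = 1%Z \/ jacobi a n = (-1)%Z.
Proof.
  intros Hn G. unfold jacobi.
  assert (H : forall p, In p (prime.primes n) -> (a mod Z.of_nat p <> 0)%Z).
  { intros p Hp E. destruct (In_primes p n Hp) as [H1 H2].
    apply Z.mod_divide in E; [|lia].
    assert (D := Z.gcd_greatest _ _ _ E H2). rewrite G in D.
    apply Z.divide_1_r_nonneg in D; lia. }
  revert H. generalize (prime.primes n) as s. induction s as [|p s IH]; intros H; simpl; [auto|].
  destruct IH as [E|E]; [intros; apply H; simpl; auto| |];
  destruct (unit_pow _ (prime.logn p n) (legendre_unit a p (H p (or_introl eq_refl)))) as [F|F];
   rewrite E, F; auto.
Qed.

(* The exponent in [nu_eta], in units of [pi i / 12]. *)
Definition eta_exponent (a b c d : Z) : Z :=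
  if Z.odd c then ((a + d) * c - b * d * (c * c - 1) - 3 * c)%Z
  else ((a + d) * c - b * d * (c * c - 1) + 3 * d - 3 - 3 * c * d)%Z.

Local Notation e r := (epi (RtoC r)).

Lemma e_plus (r s : R) : e (r + s) = Cmult (e r) (e s).
Proof. rewrite RtoC_plus; apply epi_plus. Qed.

Lemma e_1 : e 1 = RtoC (-1).
Proof.
  rewrite epi_components; simpl. rewrite Rmult_1_r, Rmult_0_r, Ropp_0, exp_0, cos_PI, sin_PI.
  unfold RtoC; f_equal; ring.
Qed.

Lemma e_half : e (1/2) = Ci.
Proof.
  rewrite epi_components; simpl. replace (PI * (1/2)) with (PI / 2) by field.
  rewrite Rmult_0_r, Ropp_0, exp_0, cos_PI2, sin_PI2. unfold Ci; f_equal; ring.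
Qed.

Lemma e_even_nat (n : nat) : e (2 * INR n) = RtoC 1.
Proof.
  induction n as [|n IH]; [simpl; rewrite Rmult_0_r; apply epi_0|].
  rewrite S_INR. replace (2 * (INR n + 1)) with (2 * INR n + (1 + 1)) by ring.
  rewrite !e_plus, IH, e_1, <- !RtoC_mult. f_equal; ring.
Qed.

Lemma e_even (n : Z) : e (2 * IZR n) = RtoC 1.
Proof.
  destruct (Z_le_dec 0 n) as [H|H].
  - rewrite <- (Z2Nat.id n), <- INR_IZR_INZ by lia. apply e_even_nat.
  - pose proof (e_even_nat (Z.to_nat (- n))) as E.
    rewrite INR_IZR_INZ, Z2Nat.id, opp_IZR in E by lia.
    pose proof (epi_opp (RtoC (2 * - IZR n))) as O. rewrite E in O.
    rewrite <- RtoC_opp in O. replace (- (2 * - IZR n)) with (2 * IZR n) in O by ring.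
    rewrite <- O; ring.
Qed.

Lemma e_congr (r s : R) (n : Z) : r = s + 2 * IZR n -> e r = e s.
Proof. intros ->; rewrite e_plus, e_even; ring. Qed.

(** The even power kills the Jacobi symbols and signs, and six times pi i / 12 is pi i / 2. Hence
    the value depends on the exponent modulo 4 only. *)
Lemma nu_eta_pow6 (a b c d : Z) : (a * d - b * c = 1)%Z ->
  Cpow (nu_eta a b c d) 6 = e (IZR (eta_exponent a b c d) / 2).
Proof.
  intros H.
  assert (Pow : forall (j f : Z), j = 1%Z \/ j = (-1)%Z ->
    Cpow (Cmult (RtoC (IZR j)) (cexp (Cmult (RtoC (PI / 12)) (Cmult Ci (RtoC (IZR f)))))) 6 =
    e (IZR f / 2)).
  { intros j f Hj.
    replace (cexp _) with (e (IZR f / 12)).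
    2:{ unfold epi; f_equal. apply C_eq; simpl; field. }
    replace (IZR f / 2) with (IZR f / 12 + (IZR f / 12 + (IZR f / 12 + (IZR f / 12 + (IZR f / 12 + IZR f / 12)))))
      by field.
    rewrite !e_plus. destruct Hj as [-> | ->]; simpl; rewrite ?RtoC_opp; ring. }
  unfold nu_eta, eta_exponent. destruct (Z.odd c) eqn:Oc; apply Pow.
  - assert (c <> 0)%Z by (intros ->; discriminate).
    apply jacobi_unit; [lia|]. rewrite Zabs2Nat.id_abs, Z.gcd_abs_r.
    apply Z.bezout_1_gcd. exists a, (- b)%Z. lia.
  (* d = 0 would force b c = -1 with c even. *)
  - assert (d <> 0)%Z.
    { intros ->. assert (E : (b * c = -1)%Z) by lia.
      apply (f_equal Z.odd) in E. rewrite Z.odd_mul, Oc, Bool.andb_false_r in E. discriminate. }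
    assert (J : jacobi c (Z.abs_nat d) = 1%Z \/ jacobi c (Z.abs_nat d) = (-1)%Z).
    { apply jacobi_unit; [lia|]. rewrite Zabs2Nat.id_abs, Z.gcd_abs_r.
      apply Z.bezout_1_gcd. exists (- b)%Z, a. lia. }
    unfold jacobi_low, sgn'. destruct (0 <? c)%Z, (0 <? d)%Z, J as [-> | ->]; vm_compute; auto.
Qed.

Definition res4 : list Z := (0 :: 1 :: 2 :: 3 :: nil)%Z.

Lemma mod4_res4 (x : Z) : In (x mod 4)%Z res4.
Proof.
  pose proof (Z.mod_pos_bound x 4 eq_refl). unfold res4; simpl. lia.
Qed.

Definition eq4 (x y : Z) : Prop := (x mod 4 = y mod 4)%Z.

#[local] Instance eq4_equiv : RelationClasses.Equivalence eq4.
Proof. unfold eq4; split; [intros x; reflexivity|intros x y H; auto|intros x y z -> ->; reflexivity]. Qed.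

#[local] Instance eq4_add : Morphisms.Proper (Morphisms.respectful eq4 (Morphisms.respectful eq4 eq4)) Z.add.
Proof. unfold eq4; intros x x' H y y' H'. rewrite Z.add_mod, H, H', <- Z.add_mod; easy. Qed.

#[local] Instance eq4_sub : Morphisms.Proper (Morphisms.respectful eq4 (Morphisms.respectful eq4 eq4)) Z.sub.
Proof. unfold eq4; intros x x' H y y' H'. rewrite Zminus_mod, H, H', <- Zminus_mod; easy. Qed.

#[local] Instance eq4_mul : Morphisms.Proper (Morphisms.respectful eq4 (Morphisms.respectful eq4 eq4)) Z.mul.
Proof. unfold eq4; intros x x' H y y' H'. rewrite Z.mul_mod, H, H', <- Z.mul_mod; easy. Qed.

#[local] Instance eq4_opp : Morphisms.Proper (Morphisms.respectful eq4 eq4) Z.opp.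
Proof. intros x x' H. rewrite <- !Z.sub_0_l. now rewrite H. Qed.

Lemma eq4_odd (x y : Z) : eq4 x y -> Z.odd x = Z.odd y.
Proof.
  intros H. rewrite (Z.div_mod x 4), (Z.div_mod y 4), H by lia.
  rewrite !Z.odd_add, !Z.odd_mul. reflexivity.
Qed.

(** On each branch the exponent is an integer polynomial, and the residue of c modulo 4 fixes its
    parity, hence the branch. *)
#[local] Instance eq4_eta_exponent : Morphisms.Proper (Morphisms.respectful eq4 (Morphisms.respectful eq4
  (Morphisms.respectful eq4 (Morphisms.respectful eq4 eq4)))) eta_exponent.
Proof.
  intros a a' Ha b b' Hb c c' Hc d d' Hd. unfold eta_exponent.
  rewrite (eq4_odd c c' Hc). destruct (Z.odd c'); rewrite Ha, Hb, Hc, Hd; reflexivity.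
Qed.

Lemma eq4_mod (x : Z) : eq4 x (x mod 4).
Proof. unfold eq4; now rewrite Z.mod_mod. Qed.

(** The two tests are left multiplication by T and by S: each raises the exponent by 1 modulo 4.
    Residues whose determinant is not 1 modulo 4 pass trivially. *)
Definition eta_check (a b c d : Z) : bool :=
  implb ((a * d - b * c) mod 4 =? 1)%Z
   (((eta_exponent (a + c) (b + d) c d) mod 4 =? (eta_exponent a b c d + 1) mod 4) &&
    ((eta_exponent (- c) (- d) a b) mod 4 =? (eta_exponent a b c d + 1) mod 4))%Z%bool.

Lemma eta_check_all :
  forallb (fun a => forallb (fun b => forallb (fun c => forallb (eta_check a b c) res4) res4) res4) res4 = true.
Proof. vm_compute; reflexivity. Qed.

Lemma eta_exponent_ST (a b c d : Z) : (a * d - b * c = 1)%Z ->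
  eq4 (eta_exponent (a + c) (b + d) c d) (eta_exponent a b c d + 1) /\
  eq4 (eta_exponent (- c) (- d) a b) (eta_exponent a b c d + 1).
Proof.
  intros H.
  pose proof eta_check_all as A.
  rewrite forallb_forall in A; specialize (A _ (mod4_res4 a)).
  rewrite forallb_forall in A; specialize (A _ (mod4_res4 b)).
  rewrite forallb_forall in A; specialize (A _ (mod4_res4 c)).
  rewrite forallb_forall in A; specialize (A _ (mod4_res4 d)).
  unfold eta_check in A.
  assert (D : ((a mod 4 * (d mod 4) - b mod 4 * (c mod 4)) mod 4 =? 1)%Z = true).
  { apply Z.eqb_eq. transitivity ((a * d - b * c) mod 4)%Z; [|now rewrite H].
    change (eq4 (a mod 4 * (d mod 4) - b mod 4 * (c mod 4)) (a * d - b * c)).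
    now rewrite <- !eq4_mod. }
  rewrite D in A; simpl implb in A.
  apply Bool.andb_true_iff in A as [A1 A2]. apply Z.eqb_eq in A1, A2.
  split.
  - rewrite (eq4_mod a), (eq4_mod b), (eq4_mod c), (eq4_mod d). exact A1.
  - rewrite (eq4_mod a), (eq4_mod b), (eq4_mod c), (eq4_mod d). exact A2.
Qed.

Lemma e_half_eq4 (x y : Z) : eq4 x y -> e (IZR x / 2) = e (IZR y / 2).
Proof.
  intros H. apply (e_congr _ _ (x / 4 - y / 4)).
  rewrite (Z.div_mod x 4) at 1 by lia. rewrite (Z.div_mod y 4) at 1 by lia. rewrite H.
  rewrite minus_IZR, !plus_IZR, !mult_IZR. field.
Qed.

(** * Symmetries and unit translation of theta constants *)

Lemma th_add1_l (p q : R) (tau : C) : 0 < Im tau -> th (p + 1) q tau = th p q tau.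
Proof.
  intros Ht. apply is_zsum_unique.
  eapply is_zsum_ext; [|apply (is_zsum_shift _ _ (exp_decay_gterm p q tau Ht)), is_zsum_th, Ht].
  intros n; cbv beta. unfold gterm. rewrite plus_IZR.
  now replace (IZR n + 1 + p) with (IZR n + (p + 1)) by ring.
Qed.

Lemma th_scal (p q p' q' : R) (tau tau' c : C) : 0 < Im tau' ->
  (forall n : Z, gterm p q tau (IZR n) = Cmult c (gterm p' q' tau' (IZR n))) ->
  th p q tau = Cmult c (th p' q' tau').
Proof.
  intros Ht H. apply is_zsum_unique.
  eapply is_zsum_ext; [|apply is_zsum_scal, is_zsum_th, Ht].
  intros n; symmetry; apply H.
Qed.

Lemma th_add1_r (p q : R) (tau : C) : 0 < Im tau ->
  th p (q + 1) tau = Cmult (e (2 * p)) (th p q tau).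
Proof.
  intros Ht; apply th_scal; [exact Ht|]. intros n; unfold gterm.
  rewrite !epi_plus.
  rewrite (e_congr (2 * (IZR n + p) * (q + 1)) (2 * p + 2 * (IZR n + p) * q) n) by ring.
  rewrite e_plus. ring.
Qed.

Lemma th_opp (p q : R) (tau : C) : 0 < Im tau -> th (- p) (- q) tau = th p q tau.
Proof.
  intros Ht. apply is_zsum_unique.
  eapply is_zsum_ext; [|apply is_zsum_opp, is_zsum_th, Ht].
  intros n; cbv beta. unfold gterm. rewrite opp_IZR. f_equal; f_equal; [f_equal|]; f_equal; ring.
Qed.

(** Since n^2 and n have the same parity, (n + p)^2 equals -(p^2 + p) + 2 (n + p) (p + 1/2) modulo
    2, and the last term is absorbed in the second characteristic. *)
Lemma th_translate (p q : R) (tau : C) : 0 < Im tau ->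
  th p q (Cplus tau (RtoC 1)) = Cmult (e (- (p ^ 2 + p))) (th p (p + q + 1/2) tau).
Proof.
  intros Ht; apply th_scal; [exact Ht|]. intros n; unfold gterm.
  rewrite Cmult_plus_distr_l, Cmult_1_r, !epi_plus.
  assert (Ev : exists m, (n * n - n = 2 * m)%Z).
  { destruct (Z.Even_or_Odd n) as [[k ->]|[k ->]];
      [exists (2 * k * k - k)%Z|exists (2 * k * k + k)%Z]; ring. }
  destruct Ev as [m Hm]. apply (f_equal IZR) in Hm. rewrite minus_IZR, !mult_IZR in Hm.
  rewrite (e_congr ((IZR n + p) ^ 2)
    (- (p ^ 2 + p) + 2 * (IZR n + p) * (p + 1/2)) m) by nra.
  replace (2 * (IZR n + p) * (p + q + 1/2)) with (2 * (IZR n + p) * (p + 1/2) + 2 * (IZR n + p) * q) by ring.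
  rewrite !e_plus. ring.
Qed.

(** * Klein forms *)

Definition klein (x y : R) (tau : C) : C :=
  Cmult (e (- (x * y + x))) (th (x + 1/2) (y + 1/2) tau).

(** The prefactor of [klein] is what frees the constant from x and y: [e (1/4)] is the value of
    nu_eta^3 at T. *)
Lemma klein_translate (x y : R) (tau : C) : 0 < Im tau ->
  klein x y (Cplus tau (RtoC 1)) = Cmult (e (1/4)) (klein x (x + y) tau).
Proof.
  intros Ht; unfold klein. rewrite th_translate by exact Ht.
  replace (x + 1/2 + (y + 1/2) + 1/2) with (x + y + 1/2 + 1) by field.
  rewrite th_add1_r by exact Ht.
  rewrite !Cmult_assoc, <- !e_plus. f_equal. apply (e_congr _ _ 0). field.
Qed.

Lemma klein_add1_l (x y : R) (tau : C) : 0 < Im tau ->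
  klein (x + 1) y tau = Cmult (e (- y - 1)) (klein x y tau).
Proof.
  intros Ht; unfold klein. replace (x + 1 + 1/2) with (x + 1/2 + 1) by ring.
  rewrite th_add1_l, Cmult_assoc, <- e_plus by exact Ht. f_equal. f_equal; f_equal; ring.
Qed.

Lemma klein_add1_r (x y : R) (tau : C) : 0 < Im tau ->
  klein x (y + 1) tau = Cmult (e (x + 1)) (klein x y tau).
Proof.
  intros Ht; unfold klein. replace (y + 1 + 1/2) with (y + 1/2 + 1) by ring.
  rewrite th_add1_r, !Cmult_assoc, <- !e_plus by exact Ht. f_equal. f_equal; f_equal; field.
Qed.

(** Theta is even in its characteristic, and reflecting about (1/2, 1/2) costs one unit shift in
    each entry, whose phases combine with the prefactor to -1. *)
Lemma klein_opp (x y : R) (tau : C) : 0 < Im tau ->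
  klein (- x) (- y) tau = Cmult (e 1) (klein x y tau).
Proof.
  intros Ht; unfold klein.
  replace (- x + 1/2) with (- (x - 1/2)) by field. replace (- y + 1/2) with (- (y - 1/2)) by field.
  rewrite th_opp by exact Ht.
  replace (x + 1/2) with (x - 1/2 + 1) by field. replace (y + 1/2) with (y - 1/2 + 1) by field.
  rewrite th_add1_l, th_add1_r by exact Ht.
  rewrite !Cmult_assoc, <- !e_plus. f_equal. apply (e_congr _ _ 0). field.
Qed.

Lemma Z_bi_ind (Q : Z -> Prop) : Q 0%Z -> (forall n, Q n <-> Q (n + 1)%Z) -> forall n, Q n.
Proof.
  intros H0 HS n. apply (Z.bi_induction Q); [|exact H0|].
  - intros x y ->; reflexivity.
  - intros m; rewrite <- Z.add_1_r; apply HS.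
Qed.

(** A unit shift brings in a sign, which cancels for shifts by 2; only even shifts arise for
    Gamma_(theta,5). *)
Lemma klein_shift_even_l (x y : R) (m : Z) (tau : C) : 0 < Im tau ->
  klein (x + 2 * IZR m) y tau = Cmult (e (- (2 * IZR m * y))) (klein x y tau).
Proof.
  intros Ht.
  assert (St : forall x, klein (x + 2) y tau = Cmult (e (- (2 * y))) (klein x y tau)).
  { intros z. replace (z + 2) with (z + 1 + 1) by ring.
    rewrite !klein_add1_l, Cmult_assoc, <- e_plus by exact Ht. f_equal.
    apply (e_congr _ _ (-1)). ring. }
  revert m; apply Z_bi_ind.
  - rewrite Rmult_0_r, Rplus_0_r, Rmult_0_l, Ropp_0, epi_0; ring.
  - intros m. rewrite plus_IZR.
    replace (x + 2 * (IZR m + 1)) with (x + 2 * IZR m + 2) by ring. rewrite St.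
    replace (- (2 * (IZR m + 1) * y)) with (- (2 * y) + - (2 * IZR m * y)) by ring.
    rewrite e_plus. split; intros E.
    + rewrite E; ring.
    + apply (f_equal (Cmult (e (2 * y)))) in E. rewrite !Cmult_assoc, <- !e_plus in E.
      replace (2 * y + - (2 * y)) with 0 in E by ring.
      rewrite epi_0, Cmult_1_l, Rplus_0_l in E. exact E.
Qed.

Lemma klein_shift_even_r (x y : R) (n : Z) (tau : C) : 0 < Im tau ->
  klein x (y + 2 * IZR n) tau = Cmult (e (2 * IZR n * x)) (klein x y tau).
Proof.
  intros Ht.
  assert (St : forall y, klein x (y + 2) tau = Cmult (e (2 * x)) (klein x y tau)).
  { intros z. replace (z + 2) with (z + 1 + 1) by ring.
    rewrite !klein_add1_r, Cmult_assoc, <- e_plus by exact Ht. f_equal.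
    apply (e_congr _ _ 1). ring. }
  revert n; apply Z_bi_ind.
  - rewrite Rmult_0_r, Rplus_0_r, Rmult_0_l, epi_0; ring.
  - intros n. rewrite plus_IZR.
    replace (y + 2 * (IZR n + 1)) with (y + 2 * IZR n + 2) by ring. rewrite St.
    replace (2 * (IZR n + 1) * x) with (2 * x + 2 * IZR n * x) by ring.
    rewrite e_plus. split; intros E.
    + rewrite E; ring.
    + apply (f_equal (Cmult (e (- (2 * x))))) in E. rewrite !Cmult_assoc, <- !e_plus in E.
      replace (- (2 * x) + 2 * x) with 0 in E by ring.
      rewrite epi_0, Cmult_1_l, Rplus_0_l in E. exact E.
Qed.

Lemma klein_shift_even (x y x' y' : R) (m n : Z) (tau : C) : 0 < Im tau ->
  x' = x + 2 * IZR m -> y' = y + 2 * IZR n ->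
  klein x' y' tau = Cmult (e (2 * IZR n * x - 2 * IZR m * y)) (klein x y tau).
Proof.
  intros Ht -> ->. rewrite klein_shift_even_l, klein_shift_even_r, Cmult_assoc, <- e_plus by exact Ht.
  (* Performing both shifts leaves the cross term -4 m n in the exponent, an even integer. *)
  f_equal. apply (e_congr _ _ (- (2 * (m * n)))). rewrite opp_IZR, !mult_IZR. ring.
Qed.

(** Each factor contributes e(-1/2) c, and the square of this is (-1)(-i tau) = i tau: the
    undetermined root c occurs only squared. *)
Lemma klein_invert2 (x1 y1 x2 y2 : R) (tau : C) : 0 < Im tau ->
  Cmult (klein x1 y1 (Copp (Cinv tau))) (klein x2 y2 (Copp (Cinv tau))) =
  Cmult (Cmult (e (1/2)) tau) (Cmult (klein y1 (- x1) tau) (klein y2 (- x2) tau)).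
Proof.
  intros Ht. destruct (th_inversion tau Ht) as (c & Hc & Inv).
  assert (S1 : forall x y, klein x y (Copp (Cinv tau)) = Cmult (Cmult (e (- (1/2))) c) (klein y (- x) tau)).
  { intros x y. unfold klein. rewrite Inv.
    replace (- x + 1/2) with (- (x + 1/2) + 1) by field. rewrite th_add1_r by exact Ht.
    set (t := th _ _ tau).
    transitivity (Cmult c (Cmult (e (- (x * y + x) + 2 * (x + 1/2) * (y + 1/2))) t));
      [rewrite e_plus; ring|].
    replace (- (x * y + x) + 2 * (x + 1/2) * (y + 1/2)) with
      (- (1/2) + (- (y * - x + y) + 2 * (y + 1/2))) by field.
    rewrite !e_plus. ring. }
  rewrite !S1.
  transitivity (Cmult (Cmult (Cmult (e (- (1/2))) (e (- (1/2)))) (Cmult c c))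
     (Cmult (klein y1 (- x1) tau) (klein y2 (- x2) tau))); [ring|].
  rewrite Hc, <- e_plus. replace (- (1/2) + - (1/2)) with (1 + 2 * IZR (-1)) by (simpl; field).
  rewrite (e_congr _ 1 (-1) eq_refl), e_1, e_half.
  replace (RtoC (-1)) with (Copp (RtoC 1)) by (rewrite <- RtoC_opp; f_equal; ring). ring.
Qed.

(** * Action of SL(2, Z) on pairs of Klein forms *)

Definition cfactor (c d : Z) (tau : C) : C := Cplus (Cmult (RtoC (IZR c)) tau) (RtoC (IZR d)).

Lemma cfactor_neq_0 (a b c d : Z) (tau : C) : (a * d - b * c = 1)%Z -> 0 < Im tau ->
  cfactor c d tau <> RtoC 0.
Proof.
  intros H Ht E. destruct tau as [t1 t2]; simpl in Ht.
  assert (E2 := f_equal Im E). assert (E1 := f_equal Re E). simpl in E1, E2.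
  assert (C0 : IZR c = 0) by nra. rewrite C0 in E1.
  assert (D0 : IZR d = 0) by nra.
  apply eq_IZR in C0, D0. subst. lia.
Qed.

Lemma Im_moebius_pos (a b c d : Z) (tau : C) : (a * d - b * c = 1)%Z -> 0 < Im tau ->
  0 < Im (moebius a b c d tau).
Proof.
  intros H Ht. pose proof (cfactor_neq_0 a b c d tau H Ht) as N.
  apply (f_equal IZR) in H. rewrite minus_IZR, !mult_IZR in H.
  unfold cfactor in N; unfold moebius. destruct tau as [t1 t2]; simpl in Ht.
  set (z := Cplus (Cmult (RtoC (IZR c)) _) _) in *.
  assert (Z2 : 0 < Re z * Re z + Im z * Im z).
  { destruct (Req_dec (Re z) 0) as [R0|R0]; [|nra].
    destruct (Req_dec (Im z) 0) as [I0|I0]; [|nra].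
    exfalso; apply N, C_eq; assumption. }
  replace (Im _) with (t2 / (Re z * Re z + Im z * Im z)); [now apply Rdiv_lt_0_compat|].
  assert (E1 : Re z = IZR c * t1 + IZR d) by (unfold z; simpl; ring).
  assert (E2 : Im z = IZR c * t2) by (unfold z; simpl; ring).
  unfold Cdiv, Cinv; simpl. fold (Re z); fold (Im z). rewrite !E1, !E2 in *.
  replace t2 with (t2 * (IZR a * IZR d - IZR b * IZR c)) at 1 by (rewrite H; ring).
  field. nra.
Qed.

(** The vectors (x, y) are rows multiplied by M on the right. Quantifying over all of them lets a
    generator composed on the left be handled by a mere change of vectors. *)
Definition klein_pair_modular (a b c d : Z) : Prop :=
  forall (tau : C) (x1 y1 x2 y2 : R), 0 < Im tau ->
  Cmult (klein x1 y1 (moebius a b c d tau)) (klein x2 y2 (moebius a b c d tau)) =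
  Cmult (Cmult (e (IZR (eta_exponent a b c d) / 2)) (cfactor c d tau))
    (Cmult (klein (x1 * IZR a + y1 * IZR c) (x1 * IZR b + y1 * IZR d) tau)
           (klein (x2 * IZR a + y2 * IZR c) (x2 * IZR b + y2 * IZR d) tau)).

Lemma moebius_T (a b c d : Z) (tau : C) : cfactor c d tau <> RtoC 0 ->
  moebius (a + c) (b + d) c d tau = Cplus (moebius a b c d tau) (RtoC 1).
Proof.
  intros N. unfold moebius, cfactor in *. rewrite !plus_IZR, !RtoC_plus. field. exact N.
Qed.

(** Left multiplication by T. An equivalence is wanted because the Euclidean descent uses negative
    powers of T as well. *)
Lemma klein_pair_modular_T (a b c d : Z) : (a * d - b * c = 1)%Z ->
  klein_pair_modular a b c d <-> klein_pair_modular (a + c) (b + d) c d.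
Proof.
  intros H. destruct (eta_exponent_ST a b c d H) as [F _]. apply e_half_eq4 in F.
  rewrite plus_IZR in F.
  replace ((IZR (eta_exponent a b c d) + 1) / 2) with (1/4 + 1/4 + IZR (eta_exponent a b c d) / 2) in F by field.
  rewrite !e_plus in F.
  assert (Tr : forall tau x y, 0 < Im tau -> klein x y (moebius (a + c) (b + d) c d tau) =
     Cmult (e (1/4)) (klein x (x + y) (moebius a b c d tau))).
  { intros tau x y Ht. rewrite moebius_T by (eapply cfactor_neq_0; eassumption).
    apply klein_translate, Im_moebius_pos; assumption. }
  split; intros G tau x1 y1 x2 y2 Ht.
  - rewrite !Tr, F by exact Ht.
    transitivity (Cmult (Cmult (e (1/4)) (e (1/4))) (Cmult (klein x1 (x1 + y1) (moebius a b c d tau))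
       (klein x2 (x2 + y2) (moebius a b c d tau)))); [ring|].
    rewrite (G tau x1 (x1 + y1) x2 (x2 + y2) Ht), !plus_IZR.
    replace (x1 * IZR a + (x1 + y1) * IZR c) with (x1 * (IZR a + IZR c) + y1 * IZR c) by ring.
    replace (x1 * IZR b + (x1 + y1) * IZR d) with (x1 * (IZR b + IZR d) + y1 * IZR d) by ring.
    replace (x2 * IZR a + (x2 + y2) * IZR c) with (x2 * (IZR a + IZR c) + y2 * IZR c) by ring.
    replace (x2 * IZR b + (x2 + y2) * IZR d) with (x2 * (IZR b + IZR d) + y2 * IZR d) by ring.
    ring.
  (* The vectors (x, y - x) are sent to (x, y) by T, so the translation lands on the wanted pair. *)
  - specialize (G tau x1 (y1 - x1) x2 (y2 - x2) Ht).
    rewrite !Tr, F, !plus_IZR in G by exact Ht.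
    replace (x1 + (y1 - x1)) with y1 in G by ring. replace (x2 + (y2 - x2)) with y2 in G by ring.
    replace (x1 * (IZR a + IZR c) + (y1 - x1) * IZR c) with (x1 * IZR a + y1 * IZR c) in G by ring.
    replace (x1 * (IZR b + IZR d) + (y1 - x1) * IZR d) with (x1 * IZR b + y1 * IZR d) in G by ring.
    replace (x2 * (IZR a + IZR c) + (y2 - x2) * IZR c) with (x2 * IZR a + y2 * IZR c) in G by ring.
    replace (x2 * (IZR b + IZR d) + (y2 - x2) * IZR d) with (x2 * IZR b + y2 * IZR d) in G by ring.
    assert (Alg : forall p q k1 k2 h z m : C, Cmult p q = RtoC 1 ->
      Cmult (Cmult q k1) (Cmult q k2) = Cmult (Cmult (Cmult (Cmult q q) h) z) m ->
      Cmult k1 k2 = Cmult (Cmult h z) m).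
    { intros p q k1 k2 h z m I E.
      transitivity (Cmult (Cmult p p) (Cmult (Cmult q k1) (Cmult q k2))).
      - transitivity (Cmult (Cmult (Cmult p q) (Cmult p q)) (Cmult k1 k2)); [rewrite I|]; ring.
      - rewrite E.
        transitivity (Cmult (Cmult (Cmult p q) (Cmult p q)) (Cmult (Cmult h z) m)); [|rewrite I]; ring. }
    apply (Alg (e (- (1/4))) (e (1/4))); [|exact G].
    rewrite <- e_plus, Rplus_opp_l; apply epi_0.
Qed.

(** Left multiplication by S. The inversion supplies e(1/2), which matches the increment of the
    exponent, and a factor M tau, which turns c tau + d into a tau + b. *)
Lemma klein_pair_modular_S (a b c d : Z) : (a * d - b * c = 1)%Z ->
  klein_pair_modular a b c d -> klein_pair_modular (- c) (- d) a b.
Proof.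
  intros H G tau x1 y1 x2 y2 Ht.
  destruct (eta_exponent_ST a b c d H) as [_ F]. apply e_half_eq4 in F.
  rewrite plus_IZR in F.
  replace ((IZR (eta_exponent a b c d) + 1) / 2) with (1/2 + IZR (eta_exponent a b c d) / 2) in F by field.
  rewrite e_plus in F.
  assert (N : cfactor c d tau <> RtoC 0) by (eapply cfactor_neq_0; eassumption).
  assert (N' : cfactor a b tau <> RtoC 0) by (apply (cfactor_neq_0 (- c) (- d)); [lia|assumption]).
  assert (E : moebius (- c) (- d) a b tau = Copp (Cinv (moebius a b c d tau))).
  { unfold moebius, cfactor in *. rewrite !opp_IZR, !RtoC_opp. field. split; assumption. }
  assert (E2 : Cmult (moebius a b c d tau) (cfactor c d tau) = cfactor a b tau).
  { unfold moebius, cfactor in *. field. assumption. }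
  rewrite E, klein_invert2 by (apply Im_moebius_pos; assumption).
  rewrite (G tau y1 (- x1) y2 (- x2) Ht), F, <- E2, !opp_IZR.
  replace (y1 * IZR a + - x1 * IZR c) with (x1 * - IZR c + y1 * IZR a) by ring.
  replace (y1 * IZR b + - x1 * IZR d) with (x1 * - IZR d + y1 * IZR b) by ring.
  replace (y2 * IZR a + - x2 * IZR c) with (x2 * - IZR c + y2 * IZR a) by ring.
  replace (y2 * IZR b + - x2 * IZR d) with (x2 * - IZR d + y2 * IZR b) by ring.
  ring.
Qed.

Lemma klein_pair_modular_Tn (a b c d n : Z) : (a * d - b * c = 1)%Z ->
  klein_pair_modular a b c d <-> klein_pair_modular (a + n * c) (b + n * d) c d.
Proof.
  intros H. revert n. apply Z_bi_ind.
  - now rewrite !Z.add_0_r.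
  - intros n. rewrite (klein_pair_modular_T (a + n * c) (b + n * d)) by lia.
    replace (a + (n + 1) * c)%Z with (a + n * c + c)%Z by ring.
    replace (b + (n + 1) * d)%Z with (b + n * d + d)%Z by ring. reflexivity.
Qed.

Lemma klein_pair_modular_1 : klein_pair_modular 1 0 0 1.
Proof.
  intros tau x1 y1 x2 y2 Ht. change (eta_exponent 1 0 0 1) with 0%Z.
  replace (0 / 2) with 0 by field. rewrite epi_0.
  replace (moebius 1 0 0 1 tau) with tau.
  2:{ unfold moebius; field. }
  unfold cfactor. rewrite !Rmult_0_r, !Rmult_1_r, !Rplus_0_r, !Rplus_0_l. ring.
Qed.

(** Euclid's algorithm on the first column: a power of T replaces a by a mod c, S moves this
    remainder to the lower left entry, and |c| decreases. At c = 0 the matrix is plus or minus a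
    power of T. *)
Lemma klein_pair_modular_all (a b c d : Z) : (a * d - b * c = 1)%Z -> klein_pair_modular a b c d.
Proof.
  remember (Z.to_nat (Z.abs c)) as k eqn:Hk. revert a b c d Hk.
  induction (lt_wf k) as [k _ IH]. intros a b c d Hk H.
  destruct (Z.eq_dec c 0) as [->|C0].
  (* Minus the identity is reached as S^2. *)
  - assert (Base : klein_pair_modular (- 1) (- 0) 0 (- 1)).
    { apply (klein_pair_modular_S 0 (-1) 1 0); [reflexivity|].
      exact (klein_pair_modular_S 1 0 0 1 eq_refl klein_pair_modular_1). }
    assert (D : ((a = 1 /\ d = 1) \/ (a = -1 /\ d = -1))%Z).
    { assert (E : (a * d = 1)%Z) by lia. apply Z.mul_eq_1 in E as E'.
      destruct E' as [-> | ->]; lia. }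
    destruct D as [[-> ->]|[-> ->]].
    + pose proof (proj1 (klein_pair_modular_Tn 1 0 0 1 b eq_refl) klein_pair_modular_1) as G.
      replace (1 + b * 0)%Z with 1%Z in G by ring. replace (0 + b * 1)%Z with b in G by ring. exact G.
    + pose proof (proj1 (klein_pair_modular_Tn (-1) 0 0 (-1) (- b) eq_refl) Base) as G.
      replace (-1 + - b * 0)%Z with (-1)%Z in G by ring. replace (0 + - b * -1)%Z with b in G by ring.
      exact G.
  - apply (klein_pair_modular_Tn a b c d (- (a / c)) H).
    assert (A : (a + - (a / c) * c = a mod c)%Z) by (rewrite Z.mod_eq by exact C0; ring).
    assert (B : (Z.abs (a mod c) < Z.abs c)%Z).
    { pose proof (Z.mod_bound_abs a c C0). assumption. }
    set (a' := (a + - (a / c) * c)%Z) in *. set (b' := (b + - (a / c) * d)%Z).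
    assert (H' : (a' * d - b' * c = 1)%Z) by (unfold a', b'; lia).
    assert (G : klein_pair_modular (- c) (- d) a' b').
    { apply (IH (Z.to_nat (Z.abs a'))); [lia|reflexivity|lia]. }
    clearbody a' b'.
    (* S has order 4, so three applications invert it. *)
    apply klein_pair_modular_S in G; [|lia]. apply klein_pair_modular_S in G; [|lia].
    apply klein_pair_modular_S in G; [|lia].
    now rewrite !Z.opp_involutive in G.
Qed.

(** * The product P and the group Gamma_(theta,5) *)

Lemma P_klein (tau : C) :
  P tau = Cmult (e (- (4/5))) (Cmult (klein (-2/5) (-2/5) tau) (klein (-2/5) (2/5) tau)).
Proof.
  unfold P. rewrite !theta_th. unfold klein.
  replace (1/5/2) with (-2/5 + 1/2) by field.
  replace (9/5/2) with (2/5 + 1/2) by field.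
  set (t1 := th (-2/5 + 1/2) (-2/5 + 1/2) tau). set (t2 := th (-2/5 + 1/2) (2/5 + 1/2) tau).
  (* The prefactors of the two Klein forms multiply to e(4/5), which the constant cancels. *)
  transitivity (Cmult (e (- (4/5) + (- (-2/5 * (-2/5) + -2/5) + - (-2/5 * (2/5) + -2/5)))) (Cmult t1 t2)).
  - replace (- (4/5) + _) with 0 by field. rewrite epi_0; ring.
  - rewrite !e_plus; ring.
Qed.

Lemma cong5_elim (x y : Z) : cong5 x y -> exists k, x = (y + 5 * k)%Z.
Proof.
  unfold cong5; intros H. exists ((x - y) / 5)%Z.
  pose proof (Z.div_mod (x - y) 5). lia.
Qed.

(** Once the entries are written as r + 5k, this reduces the congruence tests in [E_exp] to closed
    numbers. *)
Lemma cong5b_add (x y k : Z) : cong5b (x + 5 * k) y = cong5b x y.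
Proof.
  unfold cong5b. replace (x + 5 * k - y)%Z with (x - y + k * 5)%Z by ring.
  now rewrite Z_mod_plus_full.
Qed.

Lemma klein_pair_shift_even (x1 y1 x2 y2 x1' y1' x2' y2' : R) (m1 n1 m2 n2 : Z) (tau : C) :
  0 < Im tau ->
  x1' = x1 + 2 * IZR m1 -> y1' = y1 + 2 * IZR n1 ->
  x2' = x2 + 2 * IZR m2 -> y2' = y2 + 2 * IZR n2 ->
  Cmult (klein x1' y1' tau) (klein x2' y2' tau) =
  Cmult (e (2 * IZR n1 * x1 - 2 * IZR m1 * y1 + (2 * IZR n2 * x2 - 2 * IZR m2 * y2)))
    (Cmult (klein x1 y1 tau) (klein x2 y2 tau)).
Proof.
  intros Ht E1 E2 E3 E4.
  rewrite (klein_shift_even x1 y1 x1' y1' m1 n1 tau Ht E1 E2),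
    (klein_shift_even x2 y2 x2' y2' m2 n2 tau Ht E3 E4), e_plus. ring.
Qed.

Lemma klein_pair_Gamma_theta5 (a b c d : Z) (tau : C) : in_Gamma_theta5 a b c d -> 0 < Im tau ->
  Cmult (klein (-2/5 * IZR a + -2/5 * IZR c) (-2/5 * IZR b + -2/5 * IZR d) tau)
        (klein (-2/5 * IZR a + 2/5 * IZR c) (-2/5 * IZR b + 2/5 * IZR d) tau) =
  Cmult (e (E_exp a b c d / 5)) (Cmult (klein (-2/5) (-2/5) tau) (klein (-2/5) (2/5) tau)).
Proof.
  intros [H Cg] Ht.
  assert (N1 := klein_opp (-2/5) (-2/5) tau Ht). assert (N2 := klein_opp (-2/5) (2/5) tau Ht).
  replace (- (-2/5)) with (2/5) in N1, N2 by field. replace (- (2/5)) with (-2/5) in N2 by field.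
  destruct Cg as [Cg|[Cg|[Cg|Cg]]]; destruct Cg as (Ca & Cb & Cc & Cd);
    destruct (cong5_elim _ _ Ca) as [a' ->]; destruct (cong5_elim _ _ Cb) as [b' ->];
    destruct (cong5_elim _ _ Cc) as [c' ->]; destruct (cong5_elim _ _ Cd) as [d' ->];
    clear Ca Cb Cc Cd H;
    unfold E_exp, mat_cong5b; rewrite !cong5b_add;
    repeat match goal with |- context [cong5b ?x ?y] =>
      let v := eval compute in (cong5b x y) in change (cong5b x y) with v end;
    cbv beta iota zeta delta [andb].
  (* The factor 2/5 turns multiples of 5 in the entries into even integers; this is the source of
     the same four shifts in all cases. *)
  - rewrite (klein_pair_shift_even (-2/5) (-2/5) (-2/5) (2/5) _ _ _ _
      (- (a' + c')) (- (b' + d')) (- (a' - c')) (- (b' - d')) tau Ht);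
      rewrite ?opp_IZR, ?plus_IZR, ?minus_IZR, ?mult_IZR, ?plus_IZR; try (field; fail).
    (* The shifts contribute a phase linear in a', b', c', d'. The products a'b' and c'd' come from
       [E_exp] alone, with coefficient -8 after division by 5, and so drop out as even integers. *)
    f_equal. apply (e_congr _ _ (2 * b' + 4 * (a' * b') + 4 * (c' * d'))).
    rewrite !plus_IZR, !mult_IZR. field.
  (* Both vectors change sign here, and the two factors [e 1] cancel. *)
  - rewrite (klein_pair_shift_even (2/5) (2/5) (2/5) (-2/5) _ _ _ _
      (- (a' + c')) (- (b' + d')) (- (a' - c')) (- (b' - d')) tau Ht);
      rewrite ?opp_IZR, ?plus_IZR, ?minus_IZR, ?mult_IZR, ?plus_IZR; try (field; fail).
    rewrite N1, N2.
    match goal with |- Cmult (e ?r) (Cmult (Cmult _ ?k) (Cmult _ ?l)) = _ =>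
      transitivity (Cmult (e (r + (1 + 1))) (Cmult k l)); [rewrite (e_plus r (1 + 1)), (e_plus 1 1); ring|] end.
    f_equal. apply (e_congr _ _ (1 - b' + 4 * (a' * b') + 4 * (c' * d'))).
    rewrite !plus_IZR, minus_IZR, !mult_IZR. field.
  (* Now uM is a shift of v and vM a shift of -u: the factors are exchanged and one sign remains,
     which is the -5 in [E_exp]. *)
  - rewrite (klein_pair_shift_even (-2/5) (2/5) (2/5) (2/5) _ _ _ _
      (- (a' + c')) (- (b' + d')) (- (a' - c')) (- (b' - d')) tau Ht);
      rewrite ?opp_IZR, ?plus_IZR, ?minus_IZR, ?mult_IZR, ?plus_IZR; try (field; fail).
    rewrite N1.
    match goal with |- Cmult (e ?r) (Cmult ?k (Cmult _ ?l)) = _ =>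
      transitivity (Cmult (e (r + 1)) (Cmult l k)); [rewrite (e_plus r 1); ring|] end.
    f_equal. apply (e_congr _ _ (1 + 2 * d' + 4 * (a' * b') + 4 * (c' * d'))).
    rewrite !plus_IZR, !mult_IZR. field.
  (* Here uM is a shift of -v and vM a shift of u, again an exchange with one sign. *)
  - rewrite (klein_pair_shift_even (2/5) (-2/5) (-2/5) (-2/5) _ _ _ _
      (- (a' + c')) (- (b' + d')) (- (a' - c')) (- (b' - d')) tau Ht);
      rewrite ?opp_IZR, ?plus_IZR, ?minus_IZR, ?mult_IZR, ?plus_IZR; try (field; fail).
    rewrite N2.
    match goal with |- Cmult (e ?r) (Cmult (Cmult _ ?k) ?l) = _ =>
      transitivity (Cmult (e (r + 1)) (Cmult l k)); [rewrite (e_plus r 1); ring|] end.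
    f_equal. apply (e_congr _ _ (1 - 2 * d' + 4 * (a' * b') + 4 * (c' * d'))).
    rewrite !plus_IZR, minus_IZR, !mult_IZR. field.
Qed.

Theorem mainTheorem3 (a b c d : Z) (tau : C) :
  in_Gamma_theta5 a b c d -> (0 < Im tau)%R ->
  P (moebius a b c d tau) =
  Cmult (nu a b c d)
        (Cmult (Cplus (Cmult (RtoC (IZR c)) tau) (RtoC (IZR d))) (P tau)).
Proof.
  intros HG Ht. pose proof (proj1 HG) as H.
  rewrite !P_klein.
  rewrite (klein_pair_modular_all a b c d H tau _ _ _ _ Ht),
    (klein_pair_Gamma_theta5 a b c d tau HG Ht).
  unfold nu. rewrite (nu_eta_pow6 a b c d H).
  replace (cexp _) with (e (E_exp a b c d / 5)).
  - unfold cfactor. ring.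
  - unfold epi; f_equal. apply C_eq; simpl; field.
Qed.
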